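(* Let $C(B,N)$ be the free associative conformal algebra over a field $\mathbf{k}$ of characteristic $0$ generated by a well-ordered set $B$ with a bounded locality $N$. Let $S$ be a set of monic elements of $C(B,N)$ and let $Id(S)$ be the ideal of $C(B,N)$ generated by $S$. Then the following statements are equivalent. (i) $S$ is a Gröbner-Shirshov basis in $C(B,N)$. (ii) If $0\neq f\in Id(S)$, then $\bar f=\overline{[v]_{D^is}}$ for some normal $S$-word $[v]_{D^is}$. (ii)$'$ If $0\neq f\in Id(S)$, then $f=\sum_i\alpha_i[u_i]_{D^{j_i}s_i}$ (a finite sum), where each $\alpha_i\in\mathbf{k}$, each $[u_i]_{D^{j_i}s_i}$ is a normal $S$-word, and $\bar f=\overline{[u_1]_{D^{j_1}s_1}}>\overline{[u_2]_{D^{j_2}s_2}}>\cdots$. (iii) $Irr(S)$ is a $\mathbf{k}$-basis of $C(B,N|S)=C(B,N)/Id(S)$ (i.e. the images of the elements of $Irr(S)$ form a basis).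
   Context: Conformal algebras. $\mathbf{k}$ is a field of characteristic $0$. A conformal algebra is a $\mathbf{k}$-space $C$ with bilinear products $a_{(n)}b$ ($n\in\mathbb{Z}_{\ge0}$) and a linear map $D$ such that: for all $a,b$ there is $N(a,b)\in\mathbb{Z}_{\ge 0}$ with $a_{(n)}b=0$ for $n\ge N(a,b)$; $D(a_{(n)}b)=Da_{(n)}b+a_{(n)}Db$; $Da_{(n)}b=-n\,a_{(n-1)}b$ for $n>0$ and $Da_{(0)}b=0$. It is associative if $(a_{(n)}b)_{(m)}c=\sum_{t\ge0}(-1)^t\binom nt a_{(n-t)}(b_{(m+t)}c)$. An ideal is a $D$-stable subspace closed under all products with arbitrary elements on either side. For $N\in\mathbb{Z}_{\ge0}$, $C(B,N)$ is the free associative conformal algebra generated by $B$ subject to $a_{(n)}b=0$ for $a,b\in B$, $n\ge N$: any map $\varepsilon$ from $B$ to an associative conformal algebra $C$ with $\varepsilon(a)_{(n)}\varepsilon(b)=0$ for all $a,b\in B$, $n\ge N$ extends uniquely to a homomorphism $C(B,N)\to C$. Words. $T$ is the set of associative normal words $u=b_{1(n_1)}b_{2(n_2)}\cdots b_{k(n_k)}D^ib_{k+1}$ with $b_j\in B$, $0\le n_j<N$, $k,i\ge0$; $|u|=k+1$, $ind(u)=i$; $u$ is $D$-free if $ind(u)=0$. $[u]=b_{1(n_1)}(b_{2(n_2)}(\cdots(b_{k(n_k)}D^ib_{k+1})\cdots))\in C(B,N)$ is the corresponding (right-normed) normal word; square brackets always denote right-normed bracketing. It is known that $\{[u]:u\in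 T\}$ is a $\mathbf{k}$-basis of $C(B,N)$. An element of $C(B,N)$ is $D$-free if all normal words occurring in it are. $uD^l$ is $u$ with $D^ib_{k+1}$ replaced by $D^{i+l}b_{k+1}$. If $u$ is $D$-free and $0\le n<N$, $u_{(n)}v\in T$ is the concatenation; if $a$ is empty, $a_{(n)}v$ means $v$. Ordering. $B$ is well-ordered; for $u\in T$, $wt(u)=(|u|,b_1,n_1,\dots,b_k,n_k,b_{k+1},i)$, and $u>v$ iff $wt(u)>wt(v)$ lexicographically; this well-orders $T$, and $u>0$ for all $u\in T$. For $0\ne f\in C(B,N)$, $\bar f\in T$ is the largest word occurring in $f$; $\bar0=0$; $f$ is monic if $\bar f$ has coefficient $1$. Normal $S$-words. For a set $S$ of monic elements, a normal $S$-word $[u]_{D^is}$ is either (first kind) $[a_{(n)}s_{(m)}c]$ with $s\in S$, $a,c\in T$ ($a$ may be empty), $a$ and $\bar s$ $D$-free, $0\le n,m<N$; or (second kind) $[a_{(n)}D^is]$ with $s\in S$, $i\ge0$, $a\in T$ $D$-free ($a$ may be empty), $0\le n<N$. Here, for $a=b_{1(n_1)}\cdots b_{k(n_k)}b_{k+1}$, $[a_{(n)}s_{(m)}c]=b_{1(n_1)}(\cdots(b_{k+1(n)}(s_{(m)}[c]))\cdots)$ and $[a_{(n)}D^is]=b_{1(n_1)}(\cdots(b_{k+1(n)}D^is)\cdots)$. $Irr(S)$ is the set of normal words $[u]$, $u\in T$, such that $u\ne\overline{[v]_{D^is}}$ for every normal $S$-word $[v]_{D^is}$. Compositions of monic $f,g$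 (all products indices occurring in words lie in $[0,N)$): - inclusion: if $w=\bar f=a_{(n)}\bar g_{(m)}c$, $a,c\in T$, $a,\bar g$ $D$-free ($a$ may be empty), $(f,g)_w=f-[a_{(n)}g_{(m)}c]$; - right inclusion: if $w=\bar f=a_{(n)}\bar gD^i$, $a\in T$ $D$-free ($a$ may be empty), $i\ge0$, $(f,g)_w=f-[a_{(n)}D^ig]$; - intersection: if $w=\bar f_{(m)}c=a_{(n)}\bar g$, $a,c\in T$, $a,\bar f$ $D$-free, $|\bar f|+|\bar g|>|w|$, $(f,g)_w=[f_{(m)}c]-[a_{(n)}g]$; - right intersection: if $w=\bar fD^i=a_{(n)}\bar g$, $a\in T$ $D$-free, $i>0$, $(f,g)_w=D^if-[a_{(n)}g]$; - left multiplication: $b_{(n)}f$ with $b\in B$, $n\ge N$; - right multiplication: $f_{(n)}b$ with $b\in B$ and either ($\bar f$ not $D$-free and $0\le n<N$) or ($f$ not $D$-free and $n\ge N$). An element $h$ is trivial modulo $S$ if $h$ is a finite $\mathbf{k}$-linear combination of normal $S$-words $[u_i]_{D^{l_i}s_i}$ with $\overline{[u_i]_{D^{l_i}s_i}}\le\bar h$. $S$ is a Gröbner-Shirshov basis in $C(B,N)$ if all compositions of elements of $S$ are trivial modulo $S$. *)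

(* Defs.v *)
From HB Require Import structures.
From mathcomp Require Import all_boot all_order all_algebra.
From mathcomp Require Import boolp classical_sets.

Set Implicit Arguments.
Unset Strict Implicit.
Unset Printing Implicit Defensive.

Import Order.TTheory GRing.Theory.
Local Open Scope ring_scope.
Local Open Scope classical_set_scope.
Local Open Scope quotient_scope.

Record conformalAlg (k : fieldType) := ConformalAlg {
  ca_sort :> lmodType k;
  cD : {linear ca_sort -> ca_sort};
  (* [cmul n a b] is the n-th product a_(n) b *)
  cmul : nat -> ca_sort -> ca_sort -> ca_sort;
  cmul_linearl : forall n b, linear (fun a => cmul n a b);
  cmul_linearr : forall n a, linear (fun b => cmul n a b);
  cmul_local : forall a b, exists Nab : nat,
    forall n, (Nab <= n)%N -> cmul n a b = 0;
  cD_cmul : forall n a b, cD (cmul n a b) = cmul n (cD a) b + cmul n a (cD b);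
  cmul0_D : forall a b, cmul 0 (cD a) b = 0;
  cmulS_D : forall n a b, cmul n.+1 (cD a) b = - (n.+1%:R *: cmul n a b) }.

Definition conf_assoc (k : fieldType) (C : conformalAlg k) : Prop :=
  forall n m (a b c : C), cmul m (cmul n a b) c =
    \sum_(t < n.+1) ((-1) ^+ t * 'C(n, t)%:R) *: cmul (n - t) a (cmul (m + t) b c).

Definition conf_hom (k : fieldType) (C C' : conformalAlg k)
    (phi : {linear C -> C'}) : Prop :=
  (forall a, phi (cD C a) = cD C' (phi a)) /\
  (forall n a b, phi (cmul n a b) = cmul n (phi a) (phi b)).

Definition conf_ideal (k : fieldType) (C : conformalAlg k) (I : set C) : Prop :=
  [/\ I 0,
      forall (al : k) x y, I x -> I y -> I (al *: x + y),
      forall x, I x -> I (cD C x),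
      forall n a x, I x -> I (cmul n a x) &
      forall n x a, I x -> I (cmul n x a)].

Definition Id (k : fieldType) (C : conformalAlg k) (S : set C) : set C :=
  smallest (@conf_ideal k C) S.

Section QuotientSpace.
Context (k : fieldType) (C : conformalAlg k) (S : set C).

Lemma Id_ideal : conf_ideal (Id S).
Proof.
split.
- by move=> I [[]].
- move=> al x y Ix Iy I [iI SI]; case: (iI) => _ h _ _ _.
  by apply: h; [exact: Ix | exact: Iy].
- by move=> x Ix I [iI SI]; case: (iI) => _ _ h _ _; apply: h; exact: Ix.
- by move=> n a x Ix I [iI SI]; case: (iI) => _ _ _ h _; apply: h; exact: Ix.
- by move=> n x a Ix I [iI SI]; case: (iI) => _ _ _ _ h; apply: h; exact: Ix.
Qed.

Definition Idb (x : C) : bool := `[< Id S x >].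

Lemma Idb_zmod_closed : zmod_closed Idb.
Proof.
have [I0 IL _ _ _] := Id_ideal.
split; first exact/asboolP.
move=> x y /asboolP Ix /asboolP Iy; apply/asboolP.
by rewrite addrC -scaleN1r; apply: IL.
Qed.

Definition Id_zmodClosed : zmodClosed C :=
  HB.pack_for (zmodClosed C) Idb (GRing.isZmodClosed.Build C Idb Idb_zmod_closed).

Definition quotId : Type := Quotient.quot Id_zmodClosed.
HB.instance Definition _ := GRing.Zmodule.on quotId.
HB.instance Definition _ := ZmodQuotient.on quotId.

Definition quotId_scale (al : k) : quotId -> quotId :=
  lift_op1 quotId ( *:%R al).

Lemma pi_quotId_scale al :
  {morph \pi_quotId : x / al *: x >-> quotId_scale al x}.
Proof.
move=> x; unlock quotId_scale; apply/eqP; rewrite -Quotient.idealrBE.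
have [I0 IL _ _ _] := Id_ideal.
rewrite -scalerBr; have: \pi_quotId x == \pi_quotId (repr (\pi_quotId x)).
  by rewrite reprK.
rewrite -Quotient.idealrBE => /asboolP h; apply/asboolP.
by rewrite -[X in Id S X]addr0; apply: IL.
Qed.

Fact quotId_scaleA a b x :
  quotId_scale a (quotId_scale b x) = quotId_scale (a * b) x.
Proof. by elim/quotW: x => x; rewrite -!pi_quotId_scale scalerA. Qed.
Fact quotId_scale1 : left_id 1 quotId_scale.
Proof. by elim/quotW=> x; rewrite -pi_quotId_scale scale1r. Qed.
Fact quotId_scaleDr : right_distributive quotId_scale +%R.
Proof.
move=> a; elim/quotW=> x; elim/quotW=> y.
by rewrite -raddfD -!pi_quotId_scale scalerDr raddfD.
Qed.
Fact quotId_scaleDl x : {morph quotId_scale^~ x : a b / a + b}.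
Proof.
elim/quotW: x => x a b.
by rewrite -!pi_quotId_scale scalerDl raddfD.
Qed.

HB.instance Definition _ := GRing.Zmodule_isLmodule.Build k quotId
  quotId_scaleA quotId_scale1 quotId_scaleDr quotId_scaleDl.

End QuotientSpace.

(* The subfamily [(v i)_{i in P}] is a basis of [V]. *)
Definition basis_family (k : fieldType) (V : lmodType k) (I : eqType)
    (P : set I) (v : I -> V) : Prop :=
  (forall (s : seq I) (c : I -> k), uniq s -> {in s, forall i, P i} ->
     \sum_(i <- s) c i *: v i = 0 -> {in s, forall i, c i = 0}) /\
  (forall x : V, exists (s : seq I) (c : I -> k),
     {in s, forall i, P i} /\ x = \sum_(i <- s) c i *: v i).

Section Words.
Context (disp : Order.disp_t) (B : orderType disp) (N : nat).

(* [((b_1,n_1), ..., (b_k,n_k)), b_{k+1}, i] is the word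
   b_1(n_1) b_2(n_2) ... b_k(n_k) D^i b_{k+1}. *)
Definition word : Type := (seq (B * 'I_N) * B * nat)%type.
HB.instance Definition _ := Choice.copy word (seq (B * 'I_N) * B * nat)%type.

Definition wpre (u : word) : seq (B * 'I_N) := u.1.1.
Definition wlast (u : word) : B := u.1.2.
Definition wind (u : word) : nat := u.2.
Definition wlen (u : word) : nat := (size (wpre u)).+1.
Definition dfree (u : word) : bool := wind u == 0%N.

(* A left context "a_(n)", with a a possibly empty D-free word and n < N, is
   the sequence [p] of the pairs (letter, index) of a_(n); a is empty iff
   [p = [::]], and then a_(n) v means v. *)
Definition wctx (p : seq (B * 'I_N)) (v : word) : word :=
  (p ++ wpre v, wlast v, wind v).

(* u_(m) c; only meaningful when u is D-free *)
Definition wcat (u : word) (m : 'I_N) (c : word) : word :=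
  wctx (rcons (wpre u) (wlast u, m)) c.

Definition wD (u : word) (l : nat) : word := (wpre u, wlast u, (wind u + l)%N).

(* All the order structures here are lexicographic; the component |u| comes
   first, so that only letter sequences of equal length are ever compared. *)
Definition wt (u : word) : nat *l (seqlexi (B *l 'I_N) *l (B *l nat)) :=
  (wlen u, (wpre u, (wlast u, wind u))).

Definition wle (u v : word) : bool := (wt u <= wt v)%O.
Definition wlt (u v : word) : bool := (wt u < wt v)%O.

(* T with an additional least element 0, encoded as [None] *)
Definition wle0 (x y : option word) : bool :=
  match x, y with
  | None, _ => true
  | Some _, None => false
  | Some u, Some v => wle u v
  end.
Definition wlt0 (x y : option word) : bool := ~~ wle0 y x.

End Words.

Section Free.
Context (k : fieldType) (disp : Order.disp_t) (B : orderType disp) (N : nat).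

Definition bounded_locality (C : conformalAlg k) (eps : B -> C) : Prop :=
  forall a b n, (N <= n)%N -> cmul n (eps a) (eps b) = 0.

Definition is_free_conf (C : conformalAlg k) (gen : B -> C) : Prop :=
  [/\ conf_assoc C, bounded_locality gen &
      forall (C' : conformalAlg k) (eps : B -> C'),
        conf_assoc C' -> bounded_locality eps ->
        exists phi : {linear C -> C'},
          [/\ conf_hom phi, forall b, phi (gen b) = eps b &
              forall psi : {linear C -> C'}, conf_hom psi ->
                (forall b, psi (gen b) = eps b) -> psi =1 phi]].

Context (C : conformalAlg k) (gen : B -> C).

(* b_1(n_1) (b_2(n_2) ( ... (b_k(n_k) x) ... )) *)
Definition lact (p : seq (B * 'I_N)) (x : C) : C :=
  foldr (fun (bn : B * 'I_N) y => cmul bn.2 (gen bn.1) y) x p.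

Definition nword (u : word B N) : C :=
  lact (wpre u) (iter (wind u) (cD C) (gen (wlast u))).

(* [e] lists the words occurring in [f] with their (nonzero) coefficients *)
Definition expansion (f : C) (e : seq (k * word B N)) : Prop :=
  [/\ uniq (unzip2 e), {in e, forall x, x.1 != 0} &
      f = \sum_(x <- e) x.1 *: nword x.2].

Definition occurs (f : C) (u : word B N) : Prop :=
  exists2 e, expansion f e & u \in unzip2 e.

Definition elt_dfree (f : C) : Prop := forall u, occurs f u -> dfree u.

(* the largest word occurring in [f] is [w], with coefficient [al] *)
Definition lead_term (f : C) (al : k) (w : word B N) : Prop :=
  exists e, [/\ expansion f e, (al, w) \in e & {in unzip2 e, forall v, wle v w}].

Definition is_bar (f : C) (ow : option (word B N)) : Prop :=
  if ow is Some w then exists al, lead_term f al w else f = 0.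

(* The leading word of [f], [None] standing for the leading word 0 of 0.  When
   (C, gen) is C(B,N) the normal words form a basis, so exactly one [ow]
   satisfies [is_bar f ow]. *)
Definition bar (f : C) : option (word B N) := xget None [set ow | is_bar f ow].

Definition conf_monic (f : C) : Prop := exists w, lead_term f 1 w.

Section GS.
Variable S : set C.

Inductive normal_Sword : C -> Prop :=
| NormalSword1 (p : seq (B * 'I_N)) (s : C) (sb : word B N)
    (m : 'I_N) (c : word B N) :
    S s -> bar s = Some sb -> dfree sb ->
    normal_Sword (lact p (cmul m s (nword c)))
| NormalSword2 (p : seq (B * 'I_N)) (s : C) (i : nat) :
    S s -> normal_Sword (lact p (iter i (cD C) s)).

(* Irr(S) as a set of words: [u] stands for the normal word [nword u] *)
Definition Irr : set (word B N) :=
  [set u | forall x, normal_Sword x -> Some u <> bar x].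

(* [p <> [::]] says that the word a of a_(n) is not empty *)
Inductive composition : C -> Prop :=
| CompInclusion (f g : C) (fb gb : word B N) (p : seq (B * 'I_N))
    (m : 'I_N) (c : word B N) :
    S f -> S g -> bar f = Some fb -> bar g = Some gb ->
    dfree gb -> fb = wctx p (wcat gb m c) ->
    composition (f - lact p (cmul m g (nword c)))
| CompRightInclusion (f g : C) (fb gb : word B N) (p : seq (B * 'I_N))
    (i : nat) :
    S f -> S g -> bar f = Some fb -> bar g = Some gb ->
    fb = wctx p (wD gb i) ->
    composition (f - lact p (iter i (cD C) g))
| CompIntersection (f g : C) (fb gb : word B N) (p : seq (B * 'I_N))
    (m : 'I_N) (c : word B N) :
    S f -> S g -> bar f = Some fb -> bar g = Some gb ->
    dfree fb -> p <> [::] -> wcat fb m c = wctx p gb ->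
    (wlen (wcat fb m c) < wlen fb + wlen gb)%N ->
    composition (cmul m f (nword c) - lact p g)
| CompRightIntersection (f g : C) (fb gb : word B N) (p : seq (B * 'I_N))
    (i : nat) :
    S f -> S g -> bar f = Some fb -> bar g = Some gb ->
    (0 < i)%N -> p <> [::] -> wD fb i = wctx p gb ->
    composition (iter i (cD C) f - lact p g)
| CompLeftMul (f : C) (b : B) (n : nat) :
    S f -> (N <= n)%N -> composition (cmul n (gen b) f)
| CompRightMul (f : C) (fb : word B N) (b : B) (n : nat) :
    S f -> bar f = Some fb ->
    (~~ dfree fb /\ (n < N)%N) \/ (~ elt_dfree f /\ (N <= n)%N) ->
    composition (cmul n f (gen b)).

Definition trivial_mod (h : C) : Prop :=
  exists e : seq (k * C),
    [/\ {in e, forall x, normal_Sword x.2},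
        {in e, forall x, wle0 (bar x.2) (bar h)} &
        h = \sum_(x <- e) x.1 *: x.2].

Definition GS_basis : Prop := forall h, composition h -> trivial_mod h.

Definition lead_in_Id : Prop :=
  forall f, f <> 0 -> Id S f -> exists2 x, normal_Sword x & bar f = bar x.

Definition strict_expansion_in_Id : Prop :=
  forall f, f <> 0 -> Id S f ->
    exists (x : k * C) (e : seq (k * C)),
      [/\ {in x :: e, forall y, normal_Sword y.2},
          f = \sum_(y <- x :: e) y.1 *: y.2,
          bar f = bar x.2 &
          sorted (fun y z => wlt0 (bar z.2) (bar y.2)) (x :: e)].

(* The family is indexed by the words, so the images of distinct elements of
   Irr(S) are required to be distinct. *)
Definition Irr_basis : Prop :=
  basis_family Irr (fun u => \pi_(quotId S) (nword u)).

End GS.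
End Free.

Arguments is_free_conf {k disp B} N {C} gen.
Arguments conf_monic {k disp B} N {C} gen f.
Arguments GS_basis {k disp B} N {C} gen S.
Arguments lead_in_Id {k disp B} N {C} gen S.
Arguments strict_expansion_in_Id {k disp B} N {C} gen S.
Arguments Irr_basis {k disp B} N {C} gen S.

(* Main.v *)
(* The normal words span C(B,N): their span is a conformal subalgebra containing
   B, so the uniqueness in the universal property makes it everything.  They are
   independent: let A be the free algebra on the letters b^(j), b in B, j < N,
   with the derivation b^(j) |-> b^(j+1), b^(N) = 0.  Then k[D] (x) A with
   a_(n) c = a d^n(c) for a, c in A is an associative conformal algebra in which
   the letters b = b^(0) have locality N, and in it the word
   b_1(n_1) ... b_k(n_k) D^i b_(k+1) has the lexicographically largest monomial
   D^i b_1^(0) b_2^(n_1) ... b_(k+1)^(n_k).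

   For the equivalence, the two key facts about a Groebner-Shirshov basis S are
   that Id(S) is spanned by the normal S-words and that two normal S-words with
   the same leading word w differ by a combination of normal S-words with leading
   words below w.  Products leave the range of indices n < N, so only the rough
   bound [V] on the leading words of the S-words occurring is kept along the way;
   it is strict enough because every correction term of the associativity
   identity lowers an index to the left of the place where the bound is lost. *)

From HB Require Import structures.
Require Import Defs.
From mathcomp Require Import all_boot all_order all_algebra.
From mathcomp Require Import boolp classical_sets functions.
From mathcomp Require Import zify.

Set Implicit Arguments.
Unset Strict Implicit.
Unset Printing Implicit Defensive.

Import Order.TTheory GRing.Theory.
Local Open Scope ring_scope.
Local Open Scope classical_set_scope.

(** * The order on normal words *)

(** Compositions control the products of an [s] in [S] with single letters only. Products with
    longer words are derived from them in a fixed order: first [s_(n) [c]] by induction on [c], with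
    associativity inverted so that [s] meets the first letter of [c]; then [b_(n) x] for a normal
    S-word [x], which already relies on the right products; then arbitrary left factors. Most
    estimates are the same for normal words and for normal S-words. They are proved once, for a
    family of elements tagged with words and closed under [b_(n)] with [n < N]. The free algebra of
    the model is not built. Its elements appear as left multiplications on all functions on the
    monoid of letters, where the product is composition and the derivation is a commutator.
    Characteristic 0 enters through the factor i! that [D^i] acquires in divided powers. *)

Section WordOrder.
Context (disp : Order.disp_t) (B : orderType disp) (N : nat).
Implicit Types (u v w c : word B N) (p q : seq (B * 'I_N)).

Let wtT : orderType _ := (nat *l (seqlexi (B *l 'I_N) *l (B *l nat)))%type.

Lemma wlen_wctx p v : wlen (wctx p v) = (size p + wlen v)%N.
Proof. by rewrite /wlen /wctx /= size_cat addnS. Qed.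

Lemma wlen_wcat u m v : wlen (wcat u m v) = (wlen u + wlen v)%N.
Proof. by rewrite /wcat wlen_wctx size_rcons. Qed.

Lemma wlen_wD u i : wlen (wD u i) = wlen u. Proof. by []. Qed.

Lemma wctx_cat p q v : wctx (p ++ q) v = wctx p (wctx q v).
Proof. by rewrite /wctx /= catA. Qed.

Lemma wctx_wcat p u m v : wctx p (wcat u m v) = wcat (wctx p u) m v.
Proof. by rewrite /wcat /= -wctx_cat rcons_cat. Qed.

Lemma wcatA u m v n c : wcat (wcat u m v) n c = wcat u m (wcat v n c).
Proof. exact/esym/wctx_wcat. Qed.

Lemma wctx_wD p v i : wctx p (wD v i) = wD (wctx p v) i. Proof. by []. Qed.

Lemma wcat_wD u m v i : wcat u m (wD v i) = wD (wcat u m v) i. Proof. by []. Qed.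

Lemma wD0 u : wD u 0 = u.
Proof. by case: u => [[p b] i]; rewrite /wD /wind /= addn0. Qed.

Lemma wD_add u i j : wD (wD u i) j = wD u (i + j).
Proof. by rewrite /wD /wind /= addnA. Qed.

Lemma wle_total u v : wle u v || wle v u.
Proof. rewrite /wle; exact (@le_total _ wtT (wt u) (wt v)). Qed.

Lemma wltNge u v : wlt u v = ~~ wle v u.
Proof. rewrite /wlt /wle; exact (@ltNge _ wtT (wt u) (wt v)). Qed.

Lemma wleNgt u v : wle u v = ~~ wlt v u.
Proof. by rewrite wltNge negbK. Qed.

Lemma wle_refl u : wle u u. Proof. exact: lexx. Qed.
Lemma wlt_irr u : wlt u u = false. Proof. exact: ltxx. Qed.
Lemma wltW u v : wlt u v -> wle u v. Proof. exact: ltW. Qed.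
Lemma wle_trans v u w : wle u v -> wle v w -> wle u w.
Proof. exact: le_trans. Qed.
Lemma wle_lt_trans v u w : wle u v -> wlt v w -> wlt u w.
Proof. exact: le_lt_trans. Qed.
Lemma wlt_le_trans v u w : wlt u v -> wle v w -> wlt u w.
Proof. exact: lt_le_trans. Qed.

Lemma wt_inj : injective (@wt disp B N).
Proof.
move=> [[p b] i] [[q c] j]; rewrite /wt => -[_ ep eb ei].
by move: ep eb ei; rewrite /wpre /wlast /wind /= => -> -> ->.
Qed.

Lemma wle_eqVlt u v : wle u v = (u == v) || wlt u v.
Proof. rewrite /wle /wlt -(inj_eq wt_inj); exact (@le_eqVlt _ wtT (wt u) (wt v)). Qed.

Lemma wlt_neqAle u v : wlt u v = (u != v) && wle u v.
Proof. rewrite /wle /wlt -(inj_eq wt_inj); exact (@lt_neqAle _ wtT (wt u) (wt v)). Qed.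

Lemma wlt_len u v : (wlen u < wlen v)%N -> wlt u v.
Proof.
by move=> h; rewrite /wlt /wt ltxi_pair !leEnat (ltnW h) leqNgt h.
Qed.

Lemma wle_wlen u v : wle u v -> (wlen u <= wlen v)%N.
Proof. by apply: contraTT; rewrite -ltnNge -wltNge; exact: wlt_len. Qed.

Lemma wlt_wlen u v : wlt u v -> (wlen u <= wlen v)%N.
Proof. by move/wltW/wle_wlen. Qed.

Lemma wlt_ctx_len p q u v : size p = size q -> (wlen u < wlen v)%N ->
  wlt (wctx p u) (wctx q v).
Proof. by move=> e l; apply: wlt_len; rewrite !wlen_wctx e ltn_add2l. Qed.

Lemma wlt_cons (x y : B *l 'I_N) u v : wlen u = wlen v ->
  wlt (wctx [:: x] u) (wctx [:: y] v) = (x < y)%O || (x == y) && wlt u v.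
Proof.
move=> e; have e' : wlen (wctx [:: x] u) = wlen (wctx [:: y] v).
  by rewrite !wlen_wctx e.
rewrite /wlt /wt e e' !ltxi_pair !lexx /= !lexi_cons.
by case: (ltgtP x y) => //=; rewrite andbF.
Qed.

Lemma wlt_single (b b' : B) i j :
  wlt (([::], b, i) : word B N) ([::], b', j) =
  (b < b')%O || (b == b') && (i < j)%N.
Proof.
rewrite /wlt /wt !ltxi_pair !lexx /= ltEnat /=.
by case: (ltgtP b b').
Qed.

Lemma wlt_wctx p u v : wlt (wctx p u) (wctx p v) = wlt u v.
Proof.
elim: p => [|x p IH]; first by case: u v => [[? ?] ?] [[? ?] ?].
rewrite -![x :: p]cat1s !wctx_cat.
have [l|l|l] := ltngtP (wlen u) (wlen v).
- by rewrite !wlt_len ?wlen_wctx ?ltn_add2l.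
- have h q : wlt (wctx q v) (wctx q u) by rewrite wlt_len // !wlen_wctx ltn_add2l.
  move: (h p) (h [::x]) (h ([:: x] ++ p)); rewrite -wctx_cat => _ _ h1.
  rewrite wctx_cat in h1; rewrite -wctx_cat.
  have h3 := wlt_len l.
  by rewrite !wctx_cat !wltNge (wltW h1) (wltW h3).
by rewrite wlt_cons ?wlen_wctx ?l // ltxx eqxx /= IH.
Qed.

Lemma wle_wctx p u v : wle (wctx p u) (wctx p v) = wle u v.
Proof. by rewrite !wleNgt wlt_wctx. Qed.

Lemma wctx_inj p : injective (@wctx disp B N p).
Proof.
move=> [[q b] i] [[r c] j] [/eqP]; rewrite eqseq_cat // eqxx /wpre /wlast /wind /=.
by move=> /eqP -> -> ->.
Qed.

Lemma wlt_cons_lt (x y : B *l 'I_N) u v : (x < y)%O -> (wlen u <= wlen v)%N ->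
  wlt (wctx [:: x] u) (wctx [:: y] v).
Proof.
move=> h; rewrite leq_eqVlt => /predU1P[e|l]; first by rewrite wlt_cons // h.
by rewrite wlt_len // !wlen_wctx ltn_add2l.
Qed.

Lemma ltB_letter (b b' : B) (n n' : 'I_N) : (b < b')%O -> (((b, n) : B *l 'I_N) < ((b', n') : B *l 'I_N))%O.
Proof. by move=> h; rewrite ltxi_pair (ltW h) leNgt h. Qed.

Lemma ltB_index (b : B) (n n' : 'I_N) : (n < n')%N -> (((b, n) : B *l 'I_N) < ((b, n') : B *l 'I_N))%O.
Proof. by move=> h; rewrite ltxi_pair lexx. Qed.

(** Induction along the common prefix; the three cases record where the first difference sits: in
    the last letter or the exponent of [D], in the first pair, or further right. *)
Lemma wlt_same_len_ind (P : word B N -> word B N -> Prop) :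
  (forall b b' i j, (b < b')%O || (b == b') && (i < j)%N ->
     P ([::], b, i) ([::], b', j)) ->
  (forall (x y : B *l 'I_N) u v, (x < y)%O -> wlen u = wlen v ->
     P (wctx [:: x] u) (wctx [:: y] v)) ->
  (forall x u v, wlen u = wlen v -> wlt u v -> P u v ->
     P (wctx [:: x] u) (wctx [:: x] v)) ->
  forall u v, wlen u = wlen v -> wlt u v -> P u v.
Proof.
move=> H1 H2 H3 [[p b] i] [[q c] j].
elim: p q => [|x p IH] [|y q] //= e; first by rewrite wlt_single => /H1.
have e' : wlen (p, b, i) = wlen (q, c, j) by move: e; rewrite /wlen /= => -[->].
rewrite -[(x :: p, b, i)]/(wctx [:: x] (p, b, i)).
rewrite -[(y :: q, c, j)]/(wctx [:: y] (q, c, j)) wlt_cons //.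
case/orP => [h|/andP[/eqP <- h]]; first exact: H2.
by apply: H3 => //; apply: IH.
Qed.

Lemma wlt_wD u v i : wlt u v -> wlt (wD u i) (wD v i).
Proof.
have [l|l|l] := ltngtP (wlen u) (wlen v).
- by rewrite !wlt_len // wlen_wD.
- by move/wlt_wlen; rewrite leqNgt l.
move: u v l; apply: wlt_same_len_ind.
- by move=> b b' k l; rewrite /wD /= wlt_single /wind /= ltn_add2r.
- by move=> x y u v h e; rewrite -!wctx_wD wlt_cons ?h // !wlen_wD.
- by move=> x u v e h; rewrite -!wctx_wD wlt_wctx.
Qed.

Lemma wle_wD u v i : wle u v -> wle (wD u i) (wD v i).
Proof.
by rewrite !wle_eqVlt => /predU1P[->|/wlt_wD ->]; rewrite ?eqxx // orbT.
Qed.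

Lemma wle_wDr u i : wle u (wD u i).
Proof.
by rewrite /wle /wt !lexi_pair !lexx /= leEnat leq_addr.
Qed.

(** The exponent of [D] is compared last and that of [v] is 0, the least possible, so [u] and [v]
    already differ before the exponent. *)
Lemma wlt_dfree_wD u v i : dfree v -> wlt u v -> wlt (wD u i) v.
Proof.
rewrite /dfree /wind /wlt /wt !ltxi_pair wlen_wD /=.
case: u v => [[p b] k] [[q c] j] /= /eqP ->; rewrite /wind /wlast /=.
by rewrite !ltEnat /= !ltn0 !implybF.
Qed.

(* [V v e] contains the leading words of the products of [v] by words of
   length [e]: comparing the first [wlen v] letters of [u], and the indices
   between them, with those of [v], the former are not larger. *)
Definition V v (e : nat) : set (word B N) := fun u =>
  (wlen u <= wlen v + e)%N /\
  (forall w (m : 'I_N) t, dfree w -> wlt v w -> wlen t = e -> wlt u (wcat w m t)).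

Lemma V_wle v e u u' : wle u' u -> V v e u -> V v e u'.
Proof.
move=> le [l h]; split; first exact: leq_trans (wle_wlen le) l.
by move=> w m t dw vw et; apply: wle_lt_trans le (h _ _ _ dw vw et).
Qed.

Lemma V_mono v v' e u : wle v v' -> V v e u -> V v' e u.
Proof.
move=> le [l h]; split; first by apply: leq_trans l _; rewrite leq_add2r wle_wlen.
by move=> w m t dw vw et; apply: h => //; apply: wle_lt_trans le vw.
Qed.

(** The test words [wcat w m t] may be taken with [t] D-free, and a D-free word above [u] is above
    every [wD u i]. So [V], unlike a bound by one leading word, is insensitive to [D]. *)
Lemma V_wD v e u i : V v e u -> V v e (wD u i).
Proof.
move=> [l h]; split => // w m t dw vw et.
pose t0 : word B N := (wpre t, wlast t, 0%N).
have -> : t = wD t0 (wind t) by case: t {et} @t0 => [[]].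
rewrite wcat_wD.
apply: (@wlt_le_trans (wcat w m t0)); last exact: wle_wDr.
by apply: wlt_dfree_wD => //; apply: h.
Qed.

Lemma V_short v e u : (wlen u < wlen v + e)%N -> V v e u.
Proof.
move=> l; split; first exact: ltnW.
move=> w m t dw vw et; apply: wlt_len; apply: leq_trans l _.
by rewrite wlen_wcat et leq_add2r wlt_wlen.
Qed.

(** Once an index drops, only the length of what stands to its right matters. This is the situation
    of the correction terms of associativity. *)
Lemma V_cons_lt b (n n' : 'I_N) v u e : (n' < n)%N ->
  (wlen u <= wlen v + e)%N -> V (wctx [:: (b, n)] v) e (wctx [:: (b, n')] u).
Proof.
move=> h l; split; first by rewrite !wlen_wctx -addnA leq_add2l.
move=> [[[|[c i] p] d] j] m t dw vw et.
  by move/wlt_wlen: vw; rewrite wlen_wctx.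
rewrite -[((c, i) :: p, d, j)]/(wctx [:: (c, i)] (p, d, j)) in vw *.
set w := (p, d, j) in vw *; rewrite -wctx_wcat.
have lw : (wlen v <= wlen w)%N by move/wlt_wlen: vw; rewrite !wlen_wctx.
have [l'|l'] := ltnP (wlen u) (wlen (wcat w m t)).
  exact: wlt_ctx_len.
have ew : wlen v = wlen w.
  move: (wlen_wcat w m t). lia.
rewrite wlt_cons; last by apply/eqP; rewrite eqn_leq l' andbT wlen_wcat et -ew.
move: vw; rewrite wlt_cons // => /orP[vw|/andP[/eqP[<- <-] _]].
  by rewrite (lt_trans (ltB_index b h) vw).
by rewrite ltB_index.
Qed.

Lemma V_cons b (n n' : 'I_N) v u e : (n' <= n)%N ->
  V v e u -> V (wctx [:: (b, n)] v) e (wctx [:: (b, n')] u).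
Proof.
move=> h [l H]; move: h; rewrite leq_eqVlt => /predU1P[e'|/V_cons_lt]; last exact.
have {e'}-> : n' = n by apply: val_inj.
split; first by rewrite !wlen_wctx -addnA leq_add2l.
move=> [[[|[c i] p] d] j] m t dw vw et.
  by move/wlt_wlen: vw; rewrite wlen_wctx.
rewrite -[((c, i) :: p, d, j)]/(wctx [:: (c, i)] (p, d, j)) in vw *.
set w := (p, d, j) in vw *; rewrite -wctx_wcat.
have dw' : dfree w by [].
have lw : (wlen v <= wlen w)%N by move/wlt_wlen: vw; rewrite !wlen_wctx.
move: lw; rewrite leq_eqVlt => /predU1P[ew|lw]; last first.
  apply: wlt_ctx_len => //; rewrite wlen_wcat et.
  by apply: leq_ltn_trans l _; rewrite ltn_add2r.
move: vw; rewrite wlt_cons // => /orP[vw|/andP[/eqP <- vw]].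
  by apply: wlt_cons_lt => //; rewrite wlen_wcat et -ew.
by rewrite wlt_wctx; apply: H.
Qed.

(** A test word [t] of length [e + e'] is cut after its [e]-th letter. Its first part, appended to
    [w], gives a D-free word above [v'], against which the second bound can be used. *)
Lemma V_trans v v' e e' u : (0 < e)%N -> (0 < e')%N ->
  V v e v' -> V v' e' u -> V v (e + e') u.
Proof.
move=> e0 e'0 [l1 H1] [l2 H2]; split.
  by apply: leq_trans l2 _; rewrite addnA leq_add2r.
move=> w m t dw vw et.
case: t et => [[p b] i] et.
have ps : (e.-1 < size p)%N by move: et; rewrite /wlen /wpre /=; lia.
(* [c] is the [e]-th letter of [t]: a word of length [e] has [e.-1] pairs before its last letter. *)
case ep : (drop e.-1 p) => [|[c n] q].
  by move: (congr1 size ep); rewrite size_drop /=; lia.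
have -> : (p, b, i) = wcat (take e.-1 p, c, 0%N) n (q, b, i).
  by rewrite /wcat /wctx /wpre /wlast /wind /= cat_rcons -ep cat_take_drop.
rewrite -wcatA; apply: H2 => //.
  by apply: H1 => //; rewrite /wlen /= size_take ps; lia.
move: (congr1 size ep) et; rewrite size_drop /wlen /wpre /=; lia.
Qed.

Lemma wlt_V v w m t u : dfree w -> wlt v w -> V v (wlen t) u -> wlt u (wcat w m t).
Proof. by move=> dw vw [_ h]; apply: h. Qed.

(** For equal lengths the first difference of [v] and [w] survives the concatenation: D-freeness
    excludes a difference in the exponent of [D] alone, which [wcat] forgets. *)
Lemma wlt_wcat v w (n m : 'I_N) c t : wlt v w -> dfree v -> dfree w ->
  (wlen c <= wlen t)%N -> wlt (wcat v n c) (wcat w m t).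
Proof.
move=> vw dv dw l; have := wlt_wlen vw; rewrite leq_eqVlt => /predU1P[e|lw]; last first.
  by apply: wlt_len; rewrite !wlen_wcat -addSn leq_add.
move: v w e vw dv dw; apply: wlt_same_len_ind.
- move=> b b' i j h /eqP ei /eqP ej; rewrite /wind /= in ei ej; subst i j.
  move: h; rewrite ltnn andbF orbF => h.
  by apply: wlt_cons_lt => //; apply: ltB_letter.
- move=> x y u v h e _ _; rewrite -!wctx_wcat.
  by apply: wlt_cons_lt => //; rewrite !wlen_wcat e leq_add2l.
- by move=> x u v _ _ h du dv; rewrite -!wctx_wcat wlt_wctx; apply: h.
Qed.

Lemma wlt_wcat_index v (n m : 'I_N) c t : (n < m)%N ->
  (wlen c <= wlen t)%N -> wlt (wcat v n c) (wcat v m t).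
Proof.
move=> nm l; rewrite /wcat -!cats1 !wctx_cat wlt_wctx.
by apply: wlt_cons_lt => //; apply: ltB_index.
Qed.

Lemma wlt_wcatr v (m : 'I_N) c t : wlt (wcat v m c) (wcat v m t) = wlt c t.
Proof. by rewrite /wcat wlt_wctx. Qed.

Lemma V_self v (n : 'I_N) c : dfree v -> V v (wlen c) (wcat v n c).
Proof.
by move=> dv; split => [|w m t dw vw et]; rewrite ?wlen_wcat // wlt_wcat // et.
Qed.

Lemma V_single b (n : 'I_N) u e : (wlen u <= e)%N ->
  V ([::], b, 0%N) e (wctx [:: (b, n)] u).
Proof.
rewrite leq_eqVlt => /predU1P[<-|l]; first exact: (@V_self ([::], b, 0%N) n u).
by apply: V_short; rewrite wlen_wctx.
Qed.

(** * Well-foundedness of the order on words *)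

Hypothesis hB : well_founded (fun x y : B => (x < y)%O).

Lemma lt_pair_wf : well_founded (fun x y : B *l 'I_N => (x < y)%O).
Proof.
move=> [b]; move: b; apply: (well_founded_ind hB) => b IHb n.
have [L] := ubnP (nat_of_ord n).
elim: L n => [|L IHL] n.
  by rewrite ltn0.
move=> /ltnSE lL.
constructor=> -[b' n']; rewrite ltxi_pair.
case: (ltgtP b' b) => [h _|_|-> /= h].
- exact: IHb.
- by move=> h; exfalso.
by apply: IHL; apply: leq_trans lL.
Qed.

Lemma wlt_single_wf b i : Acc (fun u v => wlen u = 1%N /\ wlt u v) ([::], b, i).
Proof.
move: b i; apply: (well_founded_ind hB) => b IHb i.
have [L] := ubnP i; elim: L i => [|L IHL] i; first by rewrite ltn0.
move=> /ltnSE lL.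
constructor=> -[[[|x q] b'] j] [e]; last by case: e.
rewrite wlt_single => /orP[h|/andP[/eqP -> h]]; first exact: IHb.
by apply: IHL; apply: leq_trans lL.
Qed.

(** The lexicographic order on sequences of unbounded length is not well-founded, so accessibility
    is established for each length separately, by nested induction on the first pair and on the
    rest. *)
Lemma wlt_len_wf n u : wlen u = n.+1 ->
  Acc (fun u v => wlen u = n.+1 /\ wlt u v) u.
Proof.
elim: n u => [|n IH]; first by move=> [[[|x q] b] i] e; [exact: wlt_single_wf | case: e].
move=> [[[|x p] b] i] e; first by case: e.
have {e} : wlen (p, b, i) = n.+1 := succn_inj e.
rewrite -[(x :: p, b, i)]/(wctx [:: x] (p, b, i)).
move: (p, b, i) => {p b i} u; move: x u; apply: (well_founded_ind lt_pair_wf) => x IHx u e.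
have a := IH u e; elim: a e => {}u _ IHu e.
constructor=> -[[[|y q] c] j] [e']; first by case: e'.
have {}e' : wlen (q, c, j) = n.+1 := succn_inj e'.
rewrite -[(y :: q, c, j)]/(wctx [:: y] (q, c, j)) wlt_cons; last by rewrite e.
case/orP => [h|/andP[/eqP -> h]]; first exact: IHx.
exact: IHu.
Qed.

Lemma wlt_wf : well_founded (fun u v : word B N => wlt u v).
Proof.
move=> u; have [L] := ubnP (wlen u); elim: L u => [|L IHL] u; first by rewrite ltn0.
move=> /ltnSE lL.
have : wlen u = (size (wpre u)).+1 by []; move: (size _) => n en.
have a := wlt_len_wf en; elim: a en lL => {}u _ IH en lL; constructor=> v vu.
move: (wlt_wlen vu); rewrite leq_eqVlt => /predU1P[e|l].
  by apply: IH; rewrite ?e // -en.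
by apply: IHL; apply: leq_trans lL.
Qed.

End WordOrder.

(** * Spans and products of normal words *)

Section LinearSpan.
Context (k : fieldType) (M : lmodType k).
Implicit Types (Q X : set M).

Definition subspace Q := Q 0 /\ forall (a : k) x y, Q x -> Q y -> Q (a *: x + y).

Inductive lspan X : set M :=
| lspan0 : lspan X 0
| lspan_step (a : k) x y : X x -> lspan X y -> lspan X (a *: x + y).

Section Subspace.
Variables (Q : set M) (sQ : subspace Q).

Lemma subspace0 : Q 0. Proof. by case: sQ. Qed.
Lemma subspaceD x y : Q x -> Q y -> Q (x + y).
Proof. by case: sQ => _ h ? ?; rewrite -[x]scale1r; exact: h. Qed.
Lemma subspaceZ a x : Q x -> Q (a *: x).
Proof. by case: sQ => ? h ?; rewrite -[_ *: x]addr0; exact: h. Qed.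
Lemma subspaceN x : Q x -> Q (- x).
Proof. by rewrite -scaleN1r; exact: subspaceZ. Qed.
Lemma subspaceB x y : Q x -> Q y -> Q (x - y).
Proof. by move=> ? ?; apply: subspaceD => //; exact: subspaceN. Qed.
Lemma subspace_sum (I : eqType) (r : seq I) (F : I -> M) :
  (forall i, i \in r -> Q (F i)) -> Q (\sum_(i <- r) F i).
Proof.
move=> h; rewrite big_seq; elim/big_rec: _ => [|i x /h ? ?]; first exact: subspace0.
exact: subspaceD.
Qed.
Lemma subspaceBl x y : Q (x - y) -> Q y -> Q x.
Proof. by move=> ? ?; rewrite -(subrK y x); exact: subspaceD. Qed.
Lemma subspaceBB x y z : Q (x - y) -> Q (y - z) -> Q (x - z).
Proof. by move=> ? ?; rewrite -(subrKA y x); exact: subspaceD. Qed.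
Lemma subspaceBC x y : Q (x - y) -> Q (y - x).
Proof. by move=> ?; rewrite -opprB; exact: subspaceN. Qed.
End Subspace.

Lemma lspan_subspace X : subspace (lspan X).
Proof.
split; first exact: lspan0.
move=> a x y hx hy; elim: hx => [|b z t Xz _ IH]; first by rewrite scaler0 add0r.
by rewrite scalerDr scalerA -addrA; exact: lspan_step.
Qed.

Lemma lspan_gen X x : X x -> lspan X x.
Proof.
by move=> Xx; rewrite -[x]addr0 -[X in X + _]scale1r; apply: lspan_step => //; exact: lspan0.
Qed.

Lemma lspan_min X Q : subspace Q -> X `<=` Q -> lspan X `<=` Q.
Proof. by move=> [h0 h] sub x; elim=> // a y z Xy _; apply: h; exact: sub. Qed.

Lemma lspan_mono X X' : X `<=` X' -> lspan X `<=` lspan X'.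
Proof.
move=> sub; apply: lspan_min; first exact: lspan_subspace.
by move=> x /sub; exact: lspan_gen.
Qed.

End LinearSpan.

Lemma subspace_preim (k : fieldType) (M M' : lmodType k) (f : M -> M') (Q : set M') :
  linear f -> subspace Q -> subspace (fun x => Q (f x)).
Proof.
move=> lf [h0 h]; split=> [|a x y ? ?]; last by rewrite lf; exact: h.
by have := lf (-1) 0 0; rewrite scaler0 addr0 scaleN1r addNr => ->.
Qed.

(** [F x w] tags a generator [x] with a word [w], meant as its leading word. The two instances are
    the normal words ([is_nword]) and the normal S-words ([nsw]). *)
Definition wspan (k : fieldType) (M : lmodType k) (W : Type) (F : M -> W -> Prop)
  (P : set W) : set M := lspan (fun x => exists2 w, F x w & P w).

Section WordSpan.
Context (k : fieldType) (M : lmodType k) (W : Type) (F : M -> W -> Prop).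

Lemma wspan_subspace P : subspace (wspan F P). Proof. exact: lspan_subspace. Qed.

Lemma wspan_gen (P : set W) x w : F x w -> P w -> wspan F P x.
Proof. by move=> Fx Pw; apply: lspan_gen; exists w. Qed.

Lemma wspan_mono (P P' : set W) : P `<=` P' -> wspan F P `<=` wspan F P'.
Proof. by move=> sub; apply: lspan_mono => x [w Fx /sub]; exists w. Qed.

Lemma wspan_min P Q : subspace Q -> (forall x w, F x w -> P w -> Q x) ->
  wspan F P `<=` Q.
Proof. by move=> sQ h; apply: lspan_min => // x [w Fx Pw]; apply: h Pw. Qed.

End WordSpan.

(** * Conformal identities modulo a subspace *)

Section ConformalIdentities.
Context (k : fieldType) (C : conformalAlg k).
Local Notation D := (cD C).

HB.instance Definition _ n (a : C) :=
  GRing.isLinear.Build k C C *:%R (cmul n a) (cmul_linearr n a).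

Lemma cmul0l n (b : C) : cmul n 0 b = 0.
Proof.
by have := cmul_linearl n b (-1) 0 0; rewrite scaler0 addr0 scaleN1r addNr.
Qed.
Lemma cmulDl n (b x y : C) : cmul n (x + y) b = cmul n x b + cmul n y b.
Proof. by have := cmul_linearl n b 1 x y; rewrite !scale1r. Qed.
Lemma cmulZl n (b x : C) al : cmul n (al *: x) b = al *: cmul n x b.
Proof. by have := cmul_linearl n b al x 0; rewrite cmul0l !addr0. Qed.
Lemma cmulBl n (b x y : C) : cmul n (x - y) b = cmul n x b - cmul n y b.
Proof. by rewrite cmulDl -scaleN1r cmulZl scaleN1r. Qed.

Lemma subspace_cmull (Q : set C) n z : subspace Q -> subspace (fun x => Q (cmul n x z)).
Proof.
by apply: (@subspace_preim _ _ _ (fun x => cmul n x z)) => a x y; exact: cmul_linearl.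
Qed.

Lemma subspace_cmulr (Q : set C) n z : subspace Q -> subspace (fun x => Q (cmul n z x)).
Proof. by apply: (@subspace_preim _ _ _ (cmul n z)) => a x y; exact: cmul_linearr. Qed.

Lemma iterD_linear i : linear (iter i D).
Proof.
elim: i => [//|i IH] a x y; rewrite !iterS; have -> := IH a x y; exact: linearP.
Qed.

(** For [i > n] the scalar is 0, so the truncated difference [n - i] does no harm. *)
Lemma cmul_iterDl i n (a c : C) :
  exists al : k, cmul n (iter i D a) c = al *: cmul (n - i) a c.
Proof.
elim: i n => [|i IH] [|n] /=.
- by exists 1; rewrite scale1r.
- by exists 1; rewrite scale1r subn0.
- by exists 0; rewrite scale0r cmul0_D.
- have [al e] := IH n; exists (- (n.+1%:R * al)).
  by rewrite cmulS_D e scalerA scaleNr subSS.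
Qed.

Lemma cmulDr_sub (Q : set C) n (a x : C) : subspace Q ->
  Q (D (cmul n a x)) -> Q (cmul n.-1 a x) -> Q (cmul n a (D x)).
Proof.
move=> sQ h1 h2.
have -> : cmul n a (D x) = D (cmul n a x) - cmul n (D a) x.
  by rewrite cD_cmul addrC addKr.
apply: subspaceB => //; case: n h1 h2 => [|n] _ h2; first by rewrite cmul0_D; exact: subspace0.
by rewrite cmulS_D; apply: subspaceN => //; apply: subspaceZ.
Qed.

Lemma cD_cmul_sub (Q : set C) n (a x : C) : subspace Q ->
  (forall n', (n' < n)%N -> Q (cmul n' a x)) -> Q (D (cmul n a x) - cmul n a (D x)).
Proof.
move=> sQ h; rewrite cD_cmul addrK; case: n h => [|n] h.
  by rewrite cmul0_D; exact: subspace0.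
by rewrite cmulS_D; apply: subspaceN => //; apply: subspaceZ => //; apply: h.
Qed.

Hypothesis hA : conf_assoc C.

(** The terms with [t > 0] have a smaller left index, so brackets may be moved modulo those. No
    bound on the inner index is kept, since associativity raises it. *)
Lemma assoc_sub_lead (Q : set C) n m (a b c : C) : subspace Q ->
  (forall n' m', (n' < n)%N -> Q (cmul n' a (cmul m' b c))) ->
  Q (cmul m (cmul n a b) c - cmul n a (cmul m b c)).
Proof.
move=> sQ h; rewrite hA big_ord_recl expr0 bin0 mul1r scale1r subn0 addn0 addrC addKr.
apply: subspace_sum => // i _; apply: subspaceZ => //; apply: h.
by rewrite lift0 subnS; have := ltn_ord i; lia.
Qed.

Lemma assoc_sub (Q : set C) n m (a b c : C) : subspace Q ->
  (forall n' m', (n' <= n)%N -> Q (cmul n' a (cmul m' b c))) ->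
  Q (cmul m (cmul n a b) c).
Proof.
move=> sQ h; apply: (subspaceBl sQ (y := cmul n a (cmul m b c))); last exact: h.
by apply: assoc_sub_lead => // n' m' /ltnW; exact: h.
Qed.

(** Associativity is a unitriangular system in the left index; strong induction on [n] inverts it
    without an explicit formula. *)
Lemma assoc_sub_lead_rev (Q : set C) n m (a b c : C) : subspace Q ->
  (forall n' m', (n' < n)%N -> Q (cmul m' (cmul n' a b) c)) ->
  Q (cmul n a (cmul m b c) - cmul m (cmul n a b) c).
Proof.
move=> sQ; have [L] := ubnP n; elim: L n m => // L IH n m /ltnSE nL h.
apply: subspaceBC => //; apply: assoc_sub_lead => // n' m' n'n.
apply: (subspaceBl sQ (y := cmul m' (cmul n' a b) c)); last exact: h.
apply: IH; first exact: leq_trans nL.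
by move=> n2 m2 l; apply: h; apply: ltn_trans n'n.
Qed.

Lemma assoc_sub_rev (Q : set C) n m (a b c : C) : subspace Q ->
  (forall n' m', (n' <= n)%N -> Q (cmul m' (cmul n' a b) c)) ->
  Q (cmul n a (cmul m b c)).
Proof.
move=> sQ h; apply: (subspaceBl sQ (y := cmul m (cmul n a b) c)); last exact: h.
by apply: assoc_sub_lead_rev => // n' m' /ltnW; exact: h.
Qed.

End ConformalIdentities.

Section LeftWords.
Context (k : fieldType) (disp : Order.disp_t) (B : orderType disp) (N : nat).
Context (C : conformalAlg k) (gen : B -> C).
Hypotheses (hA : conf_assoc C) (hN : bounded_locality N gen).
Local Notation D := (cD C).
Local Notation word := (word B N).
Implicit Types (u v w c : word) (p q : seq (B * 'I_N)).

Lemma lact_linear p : linear (lact gen p : C -> C).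
Proof.
elim: p => [//|x p IH] a y z.
by rewrite -[LHS]/(cmul x.2 (gen x.1) (lact gen p (a *: y + z))) IH linearP.
Qed.

HB.instance Definition _ p :=
  GRing.isLinear.Build k C C *:%R (lact gen p) (lact_linear p).

Lemma lact_cat p q x : lact gen (p ++ q) x = lact gen p (lact gen q x).
Proof. by rewrite /lact foldr_cat. Qed.

Lemma nword_wctx p u : nword gen (wctx p u) = lact gen p (nword gen u).
Proof. by rewrite /nword lact_cat. Qed.

(* Associativity turns [b_(n) (b'_(m) x)] into terms [(b_(i) b')_(j) x], which
   vanish for i >= N. *)
Lemma cmul_cmul_gen (Q Q' : set C) b b' x : subspace Q' ->
  (forall n, Q (cmul n (gen b') x)) ->
  (forall (n : 'I_N) y, Q y -> Q' (cmul n (gen b) y)) ->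
  forall n m, Q' (cmul n (gen b) (cmul m (gen b') x)).
Proof.
move=> sQ' h1 h2 n m; apply: assoc_sub_rev => // n' m' _.
have [Nn|nN] := leqP N n'; first by rewrite hN // cmul0l; exact: subspace0.
apply: assoc_sub => // n2 m2 l; have n2N := leq_ltn_trans l nN.
exact: (h2 (Ordinal n2N)).
Qed.

Definition is_nword (x : C) u := x = nword gen u.

(** * Products modulo lower words, for any tagged family closed under left multiplication by
    letters *)

Section Generic.
Variable F : C -> word -> Prop.
Hypothesis Fctx : forall b (n : 'I_N) x w,
  F x w -> F (cmul n (gen b) x) (wctx [:: (b, n)] w).

Lemma Flact p x w : F x w -> F (lact gen p x) (wctx p w).
Proof.
move=> Fx; elim: p => [|[b n] p IH]; first by case: w Fx => [[? ?] ?].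
by rewrite -cat1s wctx_cat; apply: Fctx.
Qed.

Lemma cmul_wspan (P P' : set word) b (n : 'I_N) x :
  (forall u, P u -> P' (wctx [:: (b, n)] u)) ->
  wspan F P x -> wspan F P' (cmul n (gen b) x).
Proof.
move=> PP'; move: x; apply: wspan_min.
  apply: subspace_preim; [exact: cmul_linearr | exact: wspan_subspace].
by move=> x w Fx /PP' Pw; apply: wspan_gen Pw; apply: Fctx.
Qed.

Lemma lact_wspan (P P' : set word) p x :
  (forall u, P u -> P' (wctx p u)) -> wspan F P x -> wspan F P' (lact gen p x).
Proof.
move=> PP'; move: x; apply: wspan_min.
  apply: subspace_preim; [exact: lact_linear | exact: wspan_subspace].
by move=> x w Fx /PP' Pw; apply: wspan_gen Pw; apply: Flact.
Qed.

Lemma cmul_wspan_lt b (n n' : nat) (nN : (n < N)%N) w x : (n' < n)%N ->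
  wspan F [set u | (wlen u <= wlen w)%N] x ->
  wspan F [set u | wlt u (wctx [:: (b, Ordinal nN)] w)] (cmul n' (gen b) x).
Proof.
move=> n'n; apply: (cmul_wspan (n := Ordinal (ltn_trans n'n nN))) => u /= l.
by apply: wlt_cons_lt => //; apply: ltB_index.
Qed.

(** [D] is a derivation, and [(D b)_(n) x] is a multiple of [b_(n-1) x]: each letter that [D] passes
    costs only a term with a lowered index. *)
Lemma cD_lact p x v : wspan F [set u | (wlen u <= wlen v)%N] x ->
  wspan F [set u | (wlen u <= wlen v)%N] (D x) ->
  wspan F [set u | (wlen u <= size p + wlen v)%N] (D (lact gen p x)) /\
  wspan F [set u | wlt u (wctx p v)] (D (lact gen p x) - lact gen p (D x)).
Proof.
move=> h h'; elim: p => [|[b n] p [IH1 IH2]].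
  by split => //=; rewrite subrr; apply: subspace0; exact: wspan_subspace.
have H1 : wspan F [set u | wlt u (wctx [:: (b, n)] (wctx p v))]
  (D (lact gen ((b, n) :: p) x) - lact gen ((b, n) :: p) (D x)).
  apply: (subspaceBB (wspan_subspace _ _) (y := cmul n (gen b) (D (lact gen p x)))).
    apply: cD_cmul_sub; first exact: wspan_subspace.
    move=> n' n'n; have -> : n = Ordinal (ltn_ord n) by apply: val_inj.
    apply: cmul_wspan_lt => //; apply: lact_wspan h => u /= l.
    by rewrite !wlen_wctx leq_add2l.
  rewrite [X in _ - X]/= -linearB; apply: cmul_wspan IH2 => u /= l.
  by rewrite wlt_wctx.
have e : lact gen ((b, n) :: p) (D x) = cmul n (gen b) (lact gen p (D x)) by [].
split; last by rewrite -cat1s wctx_cat.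
apply: (subspaceBl (wspan_subspace _ _)).
  apply: wspan_mono H1 => u /= /wlt_wlen.
  by rewrite !wlen_wctx.
by apply: lact_wspan h' => u /= l; rewrite wlen_wctx leq_add2l.
Qed.

Lemma lact_cmul_lead p (z y : C) w :
  (forall n, wspan F [set u | (wlen u <= wlen w)%N] (cmul n y z)) ->
  forall n, wspan F [set u | wlt u (wctx p w)]
    (cmul n (lact gen p y) z - lact gen p (cmul n y z)).
Proof.
move=> h; elim: p => [|[b j] p IH] n.
  by rewrite subrr; apply: subspace0; exact: wspan_subspace.
rewrite -cat1s wctx_cat.
have h' m : wspan F [set u | (wlen u <= wlen (wctx p w))%N] (cmul m (lact gen p y) z).
  apply: (subspaceBl (wspan_subspace _ _)).
    by apply: wspan_mono (IH m) => u /= /wlt_wlen.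
  by apply: lact_wspan (h m) => u /= l; rewrite !wlen_wctx leq_add2l.
apply: (subspaceBB (wspan_subspace _ _) (y := cmul j (gen b) (cmul n (lact gen p y) z))).
  apply: assoc_sub_lead; [exact: hA | exact: wspan_subspace |].
  move=> n' m' l; have -> : j = Ordinal (ltn_ord j) by apply: val_inj.
  exact: cmul_wspan_lt.
rewrite [X in _ - X]/= -linearB; apply: cmul_wspan (IH n) => u /= l.
by rewrite wlt_wctx.
Qed.

(** Here [n] may be at least [N]. Rebracketing through [cmul_cmul_gen] brings the first index below
    [N], at the price of losing control of what follows; [V ([::], b, 0)] asks only for its
    length. *)
Lemma cmul_gen_lact x w :
  (forall b n, wspan F (V ([::], b, 0%N) (wlen w)) (cmul n (gen b) x)) ->
  forall p b n, wspan F (V ([::], b, 0%N) (wlen (wctx p w))) (cmul n (gen b) (lact gen p x)).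
Proof.
move=> h; elim=> [|[c j] p IH] b n; first exact: h.
apply: (@cmul_cmul_gen (wspan F [set u : word | (wlen u <= 1 + wlen (wctx p w))%N])).
- exact: wspan_subspace.
- by move=> m; apply: wspan_mono (IH c m) => u [].
move=> m y; apply: cmul_wspan => u /= l; exact: V_single.
Qed.

Section WithD.
Hypothesis FD : forall x w, F x w ->
  wspan F [set u : word | wle u (wD w 1)] (D x).

Lemma D_wspan (P P' : set word) x :
  (forall u v, P u -> wle v (wD u 1) -> P' v) -> wspan F P x -> wspan F P' (D x).
Proof.
move=> PP'; move: x; apply: wspan_min.
  apply: subspace_preim; [exact: linearP | exact: wspan_subspace].
by move=> x w Fx Pw; apply: wspan_mono (FD Fx) => u; apply: PP'.
Qed.

Lemma V_wspanD v e x : wspan F (V v e) x -> wspan F (V v e) (D x).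
Proof. by apply: D_wspan => u w Vu /V_wle; apply; exact: V_wD. Qed.

Lemma iterD_wspan_lt i v x : wspan F [set u | wlt u v] x ->
  wspan F [set u | wlt u (wD v i)] (iter i D x).
Proof.
move=> h; elim: i => [|i IH]; first by rewrite wD0.
apply: D_wspan IH => u w /= /(wlt_wD 1); rewrite wD_add addn1 => h1 h2.
exact: wle_lt_trans h2 h1.
Qed.

Lemma iterD_wspan i x w : F x w ->
  wspan F [set u : word | wle u (wD w i)] (iter i D x).
Proof.
move=> Fx; elim: i => [|i IH]; first by rewrite wD0; apply: wspan_gen Fx _; exact: wle_refl.
apply: D_wspan IH => u v /= /(wle_wD 1); rewrite wD_add addn1 => h1 h2.
exact: wle_trans h2 h1.
Qed.

Lemma iterD_lact p x w i : F x w ->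
  wspan F [set u | wlt u (wctx p (wD w i))] (iter i D (lact gen p x) - lact gen p (iter i D x)).
Proof.
move=> Fx; elim: i => [|i IH].
  by rewrite subrr; apply: subspace0; exact: wspan_subspace.
apply: (subspaceBB (wspan_subspace _ _) (y := D (lact gen p (iter i D x)))).
  rewrite iterS -linearB; have := iterD_wspan_lt 1 IH.
  by rewrite wctx_wD wctx_wD wD_add addn1.
have h j : wspan F [set u : word | (wlen u <= wlen (wD w i.+1))%N] (iter j D x).
  by apply: wspan_mono (iterD_wspan j Fx) => u /wle_wlen.
exact: (cD_lact p (h i) (h i.+1)).2.
Qed.

Lemma cmul_gen_iterD x w :
  (forall b n, wspan F (V ([::], b, 0%N) (wlen w)) (cmul n (gen b) x)) ->
  forall i b n, wspan F (V ([::], b, 0%N) (wlen w)) (cmul n (gen b) (iter i D x)).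
Proof.
move=> h; elim=> [|i IH] b n; first exact: h.
by apply: cmulDr_sub; [exact: wspan_subspace | exact: V_wspanD | exact: IH].
Qed.

End WithD.

Hypothesis Fgen : forall b n x w, F x w ->
  wspan F (V ([::], b, 0%N) (wlen w)) (cmul n (gen b) x).

(** Rebracketing never raises an index of [u], so these stay below [N], while the index of the inner
    product becomes arbitrary; [V u] tolerates exactly this. *)
Lemma cmul_word u n x w : F x w -> wspan F (V u (wlen w)) (cmul n (nword gen u) x).
Proof.
move=> Fx; case: u => [[p b] i]; elim: p n => [|[c j] p IH] n.
  rewrite /nword /=; have [al ->] := cmul_iterDl i n (gen b) x.
  apply: subspaceZ; first exact: wspan_subspace.
  apply: wspan_mono (Fgen b (n - i) Fx) => u; apply: V_mono.
  by rewrite -[(_, _, i)]/(wD ([::], b, 0%N) i) wle_wDr.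
apply: assoc_sub; [exact: hA | exact: wspan_subspace |] => n' m' l.
apply: (cmul_wspan (n := Ordinal (leq_ltn_trans l (ltn_ord j)))) (IH m') => u.
exact: V_cons.
Qed.

Lemma cmul_word_lead u (m : 'I_N) x w : F x w -> dfree u ->
  wspan F [set v | wlt v (wcat u m w)]
    (cmul m (nword gen u) x - lact gen (rcons (wpre u) (wlast u, m)) x).
Proof.
move=> Fx; case: u => [[p b] i] /eqP; rewrite /wind /= => ->.
have h n : wspan F [set u | (wlen u <= 1 + wlen w)%N] (cmul n (gen b) x).
  by apply: wspan_mono (Fgen b n Fx) => u [].
have := @lact_cmul_lead p x (gen b) (wctx [:: (b, m)] w) h m.
by rewrite /wcat -cats1 wctx_cat lact_cat; exact.
Qed.

End Generic.

Local Notation W := (wspan is_nword).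

Lemma W_ctx b (n : 'I_N) x w :
  is_nword x w -> is_nword (cmul n (gen b) x) (wctx [:: (b, n)] w).
Proof. by move=> ->. Qed.

Lemma W_word (P : set word) u : P u -> W P (nword gen u).
Proof. by move=> Pu; apply: wspan_gen Pu. Qed.

Lemma cD_nword u : W [set v | wlt v u] (D (nword gen u) - nword gen (wD u 1)).
Proof.
case: u => [[p b] i].
have h j : W [set u : word | (wlen u <= wlen (([::], b, i) : word))%N] (iter j D (gen b)).
  exact: (@W_word _ ([::], b, j)).
have := (cD_lact W_ctx p (h i) (h i.+1)).2.
by rewrite /wctx /wpre /= cats0 /nword /wind /= addn1.
Qed.

Lemma W_D x w : is_nword x w -> W [set u : word | wle u (wD w 1)] (D x).
Proof.
move=> ->; apply: (subspaceBl (wspan_subspace _ _)).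
  by apply: wspan_mono (cD_nword w) => u /= /wltW h; apply: wle_trans (wle_wDr _ _).
by apply: W_word; exact: wle_refl.
Qed.

Lemma cmul_gen_word b n x w : is_nword x w ->
  W (V ([::], b, 0%N) (wlen w)) (cmul n (gen b) x).
Proof.
move=> ->; case: w => [[p c] i].
have -> : (p, c, i) = wctx p ([::], c, i) by rewrite /wctx /= cats0.
rewrite nword_wctx; apply: (cmul_gen_lact W_ctx) => {b n} b n.
apply: (cmul_gen_iterD W_D (w := ([::], c, i))) => {b n} b n.
have [nN|nN] := leqP N n; first by rewrite hN //; apply: subspace0; exact: wspan_subspace.
apply: (@W_word _ (wcat ([::], b, 0%N) (Ordinal nN) ([::], c, 0%N))).
exact: (@V_self _ _ _ ([::], b, 0%N) (Ordinal nN) ([::], c, 0%N)).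
Qed.

Lemma cmul_words u n w : W (V u (wlen w)) (cmul n (nword gen u) (nword gen w)).
Proof. exact: (cmul_word W_ctx cmul_gen_word). Qed.

Lemma cmul_words_lead u (m : 'I_N) w : dfree u ->
  W [set v | wlt v (wcat u m w)]
    (cmul m (nword gen u) (nword gen w) - nword gen (wcat u m w)).
Proof.
move=> du; rewrite /wcat nword_wctx.
exact: (cmul_word_lead W_ctx cmul_gen_word).
Qed.

Lemma iterD_word u i :
  W [set v | wlt v (wD u i)] (iter i D (nword gen u) - nword gen (wD u i)).
Proof.
elim: i => [|i IH]; first by rewrite wD0 subrr; apply: subspace0; exact: wspan_subspace.
apply: (subspaceBB (wspan_subspace _ _) (y := D (nword gen (wD u i)))).
  rewrite iterS -linearB; have := iterD_wspan_lt W_D 1 IH.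
  by rewrite wD_add addn1.
have := cD_nword (wD u i); rewrite wD_add addn1; apply: wspan_mono => v /= h.
apply: wlt_le_trans h _; rewrite -[i.+1]addn1 -wD_add; exact: wle_wDr.
Qed.

End LeftWords.

(** * The differential model and the basis of normal words *)

Section SubConformal.
Context (k : fieldType) (X : lmodType k) (P : set X) (D : X -> X)
  (mul : nat -> X -> X -> X).

(** The axioms are required on [P] only. This serves twice: for the operator sequences on which
    locality holds, inside all operator sequences, and for the span of the normal words inside
    [C]. *)
Record conformal_on : Prop := ConformalOn {
  on_subspace : subspace P;
  on_D : forall x, P x -> P (D x);
  on_mul : forall n x y, P x -> P y -> P (mul n x y);
  on_D_linear : forall (a : k) x y, P x -> P y -> D (a *: x + y) = a *: D x + D y;
  on_mul_linearl : forall n z (a : k) x y, P x -> P y -> P z ->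
    mul n (a *: x + y) z = a *: mul n x z + mul n y z;
  on_mul_linearr : forall n z (a : k) x y, P x -> P y -> P z ->
    mul n z (a *: x + y) = a *: mul n z x + mul n z y;
  on_local : forall x y, P x -> P y ->
    exists M, forall n, (M <= n)%N -> mul n x y = 0;
  on_D_mul : forall n x y, P x -> P y -> D (mul n x y) = mul n (D x) y + mul n x (D y);
  on_mul0_D : forall x y, P x -> P y -> mul 0 (D x) y = 0;
  on_mulS_D : forall n x y, P x -> P y ->
    mul n.+1 (D x) y = - (n.+1%:R *: mul n x y) }.

Hypothesis H : conformal_on.

(** The vacuous [let] makes the predicate mention [H], so that the canonical instances attached to
    it can depend on [H]. *)
Definition sub_pred : {pred X} := let _ := H in fun x => `[< P x >].

Fact sub_pred_submod : submod_closed sub_pred.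
Proof.
have [h0 hl] := on_subspace H.
by split=> [|a x y /asboolP hx /asboolP hy]; apply/asboolP; [exact: h0 | exact: hl].
Qed.
HB.instance Definition _ := GRing.isSubmodClosed.Build k X sub_pred sub_pred_submod.

Record sub_type := SubType { sub_val : X; _ : sub_pred sub_val }.
HB.instance Definition _ := [isSub for sub_val].
HB.instance Definition _ := [Choice of sub_type by <:].
HB.instance Definition _ := [SubChoice_isSubLmodule of sub_type by <:].

Fact sub_valP (x : sub_type) : P (sub_val x).
Proof. by case: x => y h; exact/asboolP. Qed.

Definition sub_D (x : sub_type) : sub_type :=
  SubType (introT (asboolP _) (on_D H (sub_valP x))).
Definition sub_mul n (x y : sub_type) : sub_type :=
  SubType (introT (asboolP _) (on_mul H n (sub_valP x) (sub_valP y))).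

Fact sub_D_linear : linear sub_D.
Proof. by move=> a x y; apply: val_inj; rewrite /= (on_D_linear H) //; exact: sub_valP. Qed.
HB.instance Definition _ := GRing.isLinear.Build k sub_type sub_type *:%R sub_D sub_D_linear.

Fact sub_linearl n b : linear (fun a => sub_mul n a b).
Proof. by move=> a x y; apply: val_inj; rewrite /= (on_mul_linearl H) //; exact: sub_valP. Qed.
Fact sub_linearr n b : linear (fun a => sub_mul n b a).
Proof. by move=> a x y; apply: val_inj; rewrite /= (on_mul_linearr H) //; exact: sub_valP. Qed.
Fact sub_local a b : exists M, forall n, (M <= n)%N -> sub_mul n a b = 0.
Proof.
have [M h] := on_local H (sub_valP a) (sub_valP b).
by exists M => n /h e; apply: val_inj.
Qed.
Fact sub_D_mul n a b : sub_D (sub_mul n a b) = sub_mul n (sub_D a) b + sub_mul n a (sub_D b).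
Proof. by apply: val_inj; rewrite /= (on_D_mul H) //; exact: sub_valP. Qed.
Fact sub_mul0_D a b : sub_mul 0 (sub_D a) b = 0.
Proof. by apply: val_inj; rewrite /= (on_mul0_D H) //; exact: sub_valP. Qed.
Fact sub_mulS_D n a b : sub_mul n.+1 (sub_D a) b = - (n.+1%:R *: sub_mul n a b).
Proof. by apply: val_inj; rewrite /= (on_mulS_D H) //; exact: sub_valP. Qed.

Definition sub_conf : conformalAlg k := @ConformalAlg k sub_type sub_D sub_mul
  sub_linearl sub_linearr sub_local sub_D_mul sub_mul0_D sub_mulS_D.

Definition sub_conf_val : {linear sub_conf -> X} := \val.

Definition sub_conf_mk x (Px : P x) : sub_conf := SubType (introT (asboolP _) Px).

Lemma sub_conf_mkK x (Px : P x) : sub_conf_val (sub_conf_mk Px) = x.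
Proof. by []. Qed.

Lemma sub_conf_valP (x : sub_conf) : P (sub_conf_val x). Proof. exact: sub_valP. Qed.
Lemma sub_conf_inj : injective sub_conf_val. Proof. exact: val_inj. Qed.
Lemma sub_conf_mul n x y :
  sub_conf_val (cmul n x y) = mul n (sub_conf_val x) (sub_conf_val y).
Proof. by []. Qed.

End SubConformal.

(* Sequences [f] of operators on [E] stand for the polynomials
   [\sum_l f l D^l / l!], on which [Delta] is the derivation
   [[delta, -] + d/dD]; then
   [f_(n) g = \sum_i (-1)^i 'C(n, i) (f i) (Delta^(n-i) g)]. *)
Section DifferentialModel.
Context (k : fieldType) (E : lmodType k) (delta : {linear E -> E}).
Local Notation X := (nat -> E -> E).
Implicit Types (a b : E -> E) (f g h : X).

Definition ad a : E -> E := fun v => delta (a v) - a (delta v).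
Definition shift f : X := fun l => f l.+1.
Definition Delta f : X := fun l v => ad (f l) v + f l.+1 v.
Fixpoint opmul n f g : X :=
  if n is n'.+1 then fun l v => opmul n' f (Delta g) l v - opmul n' (shift f) g l v
  else fun l v => f 0%N (g l v).
(** Multiplication by [D] on divided powers: [D] times [D^(l-1)/(l-1)!] is [l D^l/l!]. At [l = 0]
    the factor [l] kills the default value [f 0.-1]. *)
Definition opD f : X := fun l v => l%:R *: f l.-1 v.

Definition op_linear f := forall l, linear (f l).
(** [i] is the degree in [D] and [j] counts commutators with [delta]. Both [shift] and [Delta] lower
    [M] by one, so bounds [M] and [M'] of the factors give locality [M + M']. *)
Definition op_bounded (M : nat) f :=
  forall i j, (M <= i + j)%N -> forall v, iter j ad (f i) v = 0.
Definition op_good f := op_linear f /\ exists M, op_bounded M f.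

Lemma lin_sub a x y : linear a -> a (x - y) = a x - a y.
Proof. by move=> la; rewrite addrC -scaleN1r la scaleN1r addrC. Qed.

Lemma lin_0 a : linear a -> a 0 = 0.
Proof. by move=> la; have := la (-1) 0 0; rewrite scaler0 addr0 scaleN1r addNr. Qed.

Lemma opE f g : (forall l v, f l v = g l v) -> f = g.
Proof. by move=> e; apply/funext => l; apply/funext => v. Qed.

Lemma ad_lin (c : k) a b v : ad (c *: a + b) v = c *: ad a v + ad b v.
Proof. by rewrite /ad !fctE linearP scalerBr opprD addrACA. Qed.

Lemma iter_ad_lin j (c : k) a b v :
  iter j ad (c *: a + b) v = c *: iter j ad a v + iter j ad b v.
Proof.
elim: j a b v => [|j IH] a b v; first by rewrite !fctE.
rewrite !iterSr; have -> : ad (c *: a + b) = c *: ad a + ad b.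
  by apply/funext => w; rewrite ad_lin !fctE.
exact: IH.
Qed.

Lemma ad_linear a : linear a -> linear (ad a).
Proof.
by move=> la c x y; rewrite /ad la !linearP la scalerBr opprD addrACA.
Qed.

Lemma shift_linear f : op_linear f -> op_linear (shift f).
Proof. by move=> lf l; exact: lf. Qed.

Lemma Delta_linear f : op_linear f -> op_linear (Delta f).
Proof.
move=> lf l c x y; rewrite /Delta (ad_linear (lf l)) (lf l.+1).
by rewrite addrACA -scalerDr.
Qed.

Lemma opmul_linear n f g : op_linear f -> op_linear g -> op_linear (opmul n f g).
Proof.
elim: n f g => [|n IH] f g lf lg l c x y /=; first by rewrite lg lf.
rewrite (IH _ _ lf (Delta_linear lg)) (IH _ _ (shift_linear lf) lg).
by rewrite scalerBr opprD addrACA.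
Qed.

Lemma opD_linear f : op_linear f -> op_linear (opD f).
Proof. by move=> lf l c x y; rewrite /opD lf scalerDr !scalerA mulrC. Qed.

Lemma Delta_lin (c : k) f g : Delta (c *: f + g) = c *: Delta f + Delta g.
Proof.
apply: opE => l v; rewrite /Delta !fctE.
have -> : (fun v => c *: f l v + g l v) = c *: f l + g l by [].
by rewrite ad_lin addrACA -scalerDr.
Qed.

Lemma opmul_linl n (c : k) f g h : opmul n (c *: f + g) h = c *: opmul n f h + opmul n g h.
Proof.
apply: opE => l v; elim: n f g h => [|n IH] f g h //=.
by rewrite !fctE /= IH -[shift _]/(c *: shift f + shift g) IH !fctE scalerBr opprD addrACA.
Qed.

Lemma opmul_linr n (c : k) f g h : op_linear h ->
  opmul n h (c *: f + g) = c *: opmul n h f + opmul n h g.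
Proof.
move=> lh; apply: opE => l v.
elim: n f g h lh => [|n IH] f g h lh /=; first by rewrite !fctE lh.
rewrite !fctE /= Delta_lin !IH //; last exact: shift_linear.
by rewrite !fctE scalerBr opprD addrACA.
Qed.

Lemma opmulD n f g h : opmul n (f + g) h = opmul n f h + opmul n g h.
Proof. by have := opmul_linl n 1 f g h; rewrite !scale1r. Qed.
Lemma opmul0l n g : opmul n 0 g = 0.
Proof.
by have := opmul_linl n (-1) 0 0 g; rewrite scaler0 addr0 scaleN1r addNr.
Qed.
Lemma opmulDr n f g h : op_linear h -> opmul n h (f + g) = opmul n h f + opmul n h g.
Proof. by move=> lh; have := opmul_linr n 1 f g lh; rewrite !scale1r. Qed.
Lemma opmul0r n h : op_linear h -> opmul n h 0 = 0.
Proof.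
by move=> lh; have := opmul_linr n (-1) 0 0 lh; rewrite scaler0 addr0 scaleN1r addNr.
Qed.
Lemma opmulNr n f h : op_linear h -> opmul n h (- f) = - opmul n h f.
Proof.
by move=> lh; have := opmul_linr n (-1) f 0 lh; rewrite opmul0r // !addr0 !scaleN1r.
Qed.
Lemma opmulS n f g : opmul n.+1 f g = opmul n f (Delta g) - opmul n (shift f) g.
Proof. by []. Qed.

(** The Leibniz rule of the model has an extra term that raises the index of the product; it is the
    term that makes the induction for associativity close. *)
Lemma Delta_opmul n f g : op_linear f ->
  Delta (opmul n f g) = opmul n (Delta f) g + opmul n.+1 f g.
Proof.
elim: n f g => [|n IH] f g lf.
  apply: opE => l v; rewrite !fctE /= /Delta /ad /shift.
  have fD x y : f 0%N (x + y) = f 0%N x + f 0%N y.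
    by rewrite -[x]scale1r (lf 0%N) !scale1r.
  rewrite fD (lin_sub _ _ (lf 0%N)) [RHS]addrACA subrr addr0.
  by rewrite -(addrA (f 0%N (delta _))) [RHS]addrA subrK addrA.
have D2 x y : Delta (x - y) = Delta x - Delta y.
  by rewrite addrC -scaleN1r Delta_lin scaleN1r addrC.
rewrite opmulS D2 !IH //; last exact: shift_linear.
rewrite [opmul n.+1 (Delta f) g]opmulS [opmul n.+2 f g]opmulS.
by rewrite opprD addrACA.
Qed.

(** [shift] and [Delta] both have commutator 1 with multiplication by [D], and the two resulting
    terms cancel. *)
Lemma opD_opmul n f g : op_linear f ->
  opD (opmul n f g) = opmul n (opD f) g + opmul n f (opD g).
Proof.
have D2 x y : opD (x - y) = opD x - opD y.
  by apply: opE => l v; rewrite /opD !fctE scalerBr.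
have Dsh x : shift (opD x) = x + opD (shift x).
  apply: opE => -[|l] v; rewrite /opD /shift !fctE /=; first by rewrite scale1r scale0r addr0.
  by rewrite -[X in X%:R *: _]add1n natrD scalerDl scale1r.
have DD x : opD (Delta x) = Delta (opD x) - x.
  apply: opE => l v; rewrite /opD /Delta /ad !fctE /=.
  rewrite linearZ -scalerBr; case: l => [|l] /=; first by rewrite !scale0r scale1r add0r subrr.
  by rewrite -[X in X%:R *: x l.+1 v]add1n natrD scalerDl scale1r scalerDr addrA [RHS]addrAC addrK.
elim: n f g => [|n IH] f g lf.
  apply: opE => l v; rewrite !fctE /= /opD scale0r add0r.
  have := lf 0%N l%:R (g l.-1 v) 0; rewrite !addr0 => ->.
  by rewrite (lin_0 (lf 0%N)) addr0.
rewrite !opmulS D2 !IH //; last exact: shift_linear.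
rewrite DD opmulDr // opmulNr // Dsh opmulD -!addrA; congr (_ + _).
by rewrite [RHS]addrCA !opprD; congr (_ + _); rewrite addrA.
Qed.

Lemma opmul0_D f g : opmul 0 (opD f) g = 0.
Proof. by apply: opE => l v; rewrite /= /opD scale0r. Qed.

Lemma opmulS_D n f g : opmul n.+1 (opD f) g = - (n.+1%:R *: opmul n f g).
Proof.
have Dsh x : shift (opD x) = x + opD (shift x).
  apply: opE => -[|l] v; rewrite /opD /shift !fctE /=; first by rewrite scale1r scale0r addr0.
  by rewrite -[X in X%:R *: _]add1n natrD scalerDl scale1r.
elim: n f g => [|n IH] f g.
  by rewrite opmulS Dsh opmulD !opmul0_D addr0 sub0r scale1r.
rewrite opmulS Dsh opmulD !IH opmulS -[n.+2]add1n natrD scalerDl scale1r scalerBr.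
set x := opmul n f _ - _; rewrite opprD opprK [RHS]opprD opprB addrCA.
by congr (_ + _); rewrite opprB addrC.
Qed.

Lemma opmul_comp n (a : E -> E) g h : linear a ->
  opmul n (fun l v => a (g l v)) h = fun l v => a (opmul n g h l v).
Proof.
move=> la; elim: n g h => [//|n IH] g h.
rewrite opmulS -[shift _]/(fun l v => a (shift g l v)) !IH.
apply: opE => l v; rewrite !fctE opmulS !fctE.
by rewrite lin_sub.
Qed.

Lemma opmul_assoc n m f g h : op_linear f -> op_linear g -> op_linear h ->
  opmul m (opmul n f g) h =
  \sum_(t < n.+1) ((-1) ^+ t * 'C(n, t)%:R) *: opmul (n - t) f (opmul (m + t) g h).
Proof.
elim: n m f g => [|n IH] m f g lf lg lh.
  rewrite big_ord_recl big_ord0 addr0 expr0 mul1r scale1r addn0.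
  exact: opmul_comp (lf 0%N).
rewrite opmulS -scaleN1r addrC opmul_linl scaleN1r addrC.
rewrite !IH //; [|exact: shift_linear | exact: Delta_linear].
rewrite [RHS]big_ord_recl.
(* Pascal's rule splits the coefficient. The first half joins the term at [t = 0] to form products
   with left index raised by one. *)
have e (i : 'I_n.+1) : ((-1) ^+ lift ord0 i * 'C(n.+1, lift ord0 i)%:R) *:
    opmul (n.+1 - lift ord0 i) f (opmul (m + lift ord0 i) g h) =
  ((-1) ^+ i.+1 * 'C(n, i.+1)%:R) *: opmul (n - i) f (opmul (m + i.+1) g h) -
  ((-1) ^+ i * 'C(n, i)%:R) *: opmul (n - i) f (opmul (m + i.+1) g h).
  rewrite lift0 subSS binS natrD mulrDr scalerDl; congr (_ + _).
  by rewrite exprS mulN1r mulNr scaleNr.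
rewrite (eq_bigr _ (fun i _ => e i)).
rewrite sumrB addrA.
rewrite expr0 bin0 mul1r scale1r subn0 addn0.
have -> : opmul n.+1 f (opmul m g h) +
    \sum_(i < n.+1) ((-1) ^+ i.+1 * 'C(n, i.+1)%:R) *: opmul (n - i) f (opmul (m + i.+1) g h) =
   \sum_(i < n.+1) ((-1) ^+ i * 'C(n, i)%:R) *: opmul (n - i).+1 f (opmul (m + i) g h).
  apply/esym; rewrite big_ord_recl; congr (_ + _); first by rewrite expr0 bin0 mul1r scale1r subn0 addn0.
  apply/esym; rewrite big_ord_recr bin_small // mulr0 scale0r Monoid.mulm1.
  by apply: eq_bigr => i _; rewrite lift0 subnSK.
rewrite -!sumrB; apply: eq_bigr => i _.
(* Termwise, expanding the raised left index applies [Delta] to the inner product, and the extra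
   term of [Delta_opmul] cancels against the second sum. *)
rewrite -!scalerBr opmulS Delta_opmul // opmulDr // addnS; congr (_ *: _).
by rewrite [RHS]addrAC addrK.
Qed.

Lemma op_boundedW M M' f : (M <= M')%N -> op_bounded M f -> op_bounded M' f.
Proof. by move=> l h i j ij; apply: h; apply: leq_trans ij. Qed.

Lemma op_bounded0 f : op_bounded 0 f -> f = 0.
Proof. by move=> h; apply: opE => l v; exact: (h l 0%N). Qed.

Lemma op_bounded_shift M f : op_bounded M f -> op_bounded M.-1 (shift f).
Proof. by move=> h i j l; apply: h; lia. Qed.

Lemma op_bounded_Delta M f : op_bounded M f -> op_bounded M.-1 (Delta f).
Proof.
move=> h i j l v; rewrite /Delta.
have -> : (fun v => ad (f i) v + f i.+1 v) = 1 *: ad (f i) + f i.+1.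
  by apply/funext => w; rewrite !fctE scale1r.
by rewrite iter_ad_lin -iterSr !h ?scaler0 ?addr0 //; lia.
Qed.

Lemma opmul_eq0 M M' f g n : op_linear f -> op_bounded M f -> op_bounded M' g ->
  (M + M' <= n)%N -> opmul n f g = 0.
Proof.
elim: n M M' f g => [|n IH] [|M] [|M'] f g lf bf bg l;
  rewrite ?(op_bounded0 bf) ?(op_bounded0 bg) ?opmul0l ?opmul0r //.
rewrite opmulS (IH M.+1 M') ?(IH M M'.+1) ?subrr //; try lia.
- exact: shift_linear.
- exact: (op_bounded_shift bf).
- exact: (op_bounded_Delta bg).
Qed.

Lemma iter_ad0 j : iter j ad 0 = 0.
Proof.
elim: j => [//|j IH]; rewrite iterS IH; apply/funext => v.
by rewrite /ad [X in delta X]/= linear0 subrr.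
Qed.

(** By Leibniz each application of [ad] hits one of the two factors, and [p + q] applications
    exhaust one of them. *)
Lemma ad_comp (a b : E -> E) p q : linear a ->
  (forall v, iter p ad a v = 0) -> (forall v, iter q ad b v = 0) ->
  forall v, iter (p + q) ad (fun v => a (b v)) v = 0.
Proof.
have [L] := ubnP (p + q); elim: L p q a b => // L IH p q a b l la ha hb v.
have a0 := lin_0 la.
have Z c : (forall v, c v = 0) -> c = 0 by move=> h; apply/funext => w; rewrite h.
case: p l ha => [|p] l ha.
  have -> : (fun v => a (b v)) = 0 by apply: Z => w; exact: ha.
  by rewrite iter_ad0.
case: q l hb => [|q] l hb.
  have -> : (fun v => a (b v)) = 0 by apply: Z => w; rewrite [b w]hb a0.
  by rewrite iter_ad0.
rewrite addSn iterSr.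
have -> : ad (fun v => a (b v)) = 1 *: (fun v => ad a (b v)) + (fun v => a (ad b v)).
  apply/funext => w; rewrite !fctE scale1r /ad.
  by rewrite lin_sub // subrKA.
rewrite iter_ad_lin.
have -> : iter (p + q.+1) ad (fun v => ad a (b v)) v = 0.
  apply: IH => //; [exact: ad_linear | by move=> w; rewrite -iterSr].
rewrite scaler0 add0r -addSnnS; apply: IH => //; first by rewrite addSnnS.
by move=> w; rewrite -iterSr.
Qed.

Lemma op_bounded_mul M M' n f g : op_linear f -> op_bounded M f -> op_bounded M' g ->
  op_bounded (M + M') (opmul n f g).
Proof.
elim: n f g => [|n IH] f g lf bf bg i j l v.
  have f0 := lin_0 (lf 0%N).
  rewrite /=; have [li|li] := leqP M' i.
    have -> : (fun v => f 0%N (g i v)) = 0.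
      by apply/funext => w; rewrite [g i w](bg i 0%N) ?addn0.
    by rewrite iter_ad0.
  (* [g i] vanishes after [M' - i] applications of [ad], which leaves at least [M] of them for
     [f 0]. *)
  have -> : j = (j - (M' - i) + (M' - i))%N by lia.
  by apply: ad_comp => // w; [apply: bf | apply: bg]; lia.
have -> : opmul n.+1 f g i = (-1) *: opmul n (shift f) g i + opmul n f (Delta g) i.
  by apply/funext => w; rewrite opmulS !fctE scaleN1r addrC.
rewrite iter_ad_lin !IH ?scaler0 ?addr0 //.
- by apply: op_boundedW (op_bounded_Delta bg); lia.
- exact: shift_linear.
- by apply: op_boundedW (op_bounded_shift bf); lia.
Qed.

Lemma op_bounded_D M f : op_bounded M f -> op_bounded M.+1 (opD f).
Proof.
move=> h [|i] j l v.
  have -> : opD f 0 = 0 by apply/funext => w; rewrite /opD scale0r.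
  by rewrite iter_ad0.
have -> : opD f i.+1 = i.+1%:R *: f i + 0 by rewrite addr0.
by rewrite iter_ad_lin iter_ad0 h ?scaler0 ?addr0 //; lia.
Qed.

Lemma op_good_conformal : conformal_on op_good opD opmul.
Proof.
split.
- split.
    split=> [l c x y|].
      by change (0 = c *: 0 + 0 :> E); rewrite scaler0 addr0.
    by exists 0%N => i j _ v; rewrite iter_ad0.
  move=> c f g [lf [M bf]] [lg [M' bg]]; split.
    by move=> l a x y; rewrite !fctE lf lg !scalerDr !scalerA [a * c]mulrC addrACA.
  exists (M + M')%N => i j l v.
  have -> : (c *: f + g) i = c *: f i + g i by [].
  by rewrite iter_ad_lin bf ?bg ?scaler0 ?addr0 //; lia.
- move=> f [lf [M bf]]; split; first exact: opD_linear.
  by exists M.+1; exact: op_bounded_D.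
- move=> n f g [lf [M bf]] [lg [M' bg]]; split; first exact: opmul_linear.
  by exists (M + M')%N; exact: op_bounded_mul.
- move=> c f g _ _; apply: opE => l v.
  by rewrite /opD !fctE scalerDr !scalerA mulrC.
- by move=> n h c f g _ _ _; exact: opmul_linl.
- by move=> n h c f g _ _ [lh _]; exact: opmul_linr.
- move=> f g [lf [M bf]] [lg [M' bg]]; exists (M + M')%N => n l.
  exact: opmul_eq0 bf bg l.
- by move=> n f g [lf _] _; exact: opD_opmul.
- by move=> f g _ _; exact: opmul0_D.
- by move=> n f g _ _; exact: opmulS_D.
Qed.

Definition op_conf : conformalAlg k := sub_conf op_good_conformal.
Definition op_val : {linear op_conf -> X} := sub_conf_val op_good_conformal.

Lemma op_conf_assoc : conf_assoc op_conf.
Proof.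
move=> n m a b c; apply: (@sub_conf_inj _ _ _ _ _ op_good_conformal).
rewrite linear_sum; under eq_bigr do rewrite linearZ.
have [la _] := sub_conf_valP a; have [lb _] := sub_conf_valP b.
have [lc _] := sub_conf_valP c.
exact: opmul_assoc.
Qed.

End DifferentialModel.

(* Here [E] consists of the functionals on the free monoid on the letters
   (b, j), where (b, j) stands for the derivative of order N - 1 - j of b; so
   [raise] is dual to the derivation, and the b = (b, N - 1) have locality N. *)
Section WordModel.
Context (k : fieldType) (hk : [pchar k]%R =i pred0).
Context (disp : Order.disp_t) (B : orderType disp) (N : nat) (N0 : (0 < N)%N).
Local Notation letters := (seq (B * nat)).
Local Notation E := (letters -> k^o).

Fixpoint raise (w : letters) (v : E) : k :=
  if w is x :: w' then v ((x.1, x.2.+1) :: w') + raise w' (fun t => v (x :: t)) else 0.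

Lemma raise_lin w (a : k) (v v' : E) :
  raise w (fun t => a * v t + v' t) = a * raise w v + raise w v'.
Proof.
elim: w v v' => [|x w IH] v v' /=; first by rewrite mulr0 addr0.
by rewrite IH mulrDr addrACA.
Qed.

Lemma raise0 w : raise w (fun=> 0) = 0.
Proof.
by have := raise_lin w (-1) (fun=> 0) (fun=> 0); rewrite mulr0 addr0 mulN1r addNr.
Qed.

Lemma raiseZ w (a : k) (v : E) : raise w (fun t => a * v t) = a * raise w v.
Proof.
have := raise_lin w a v (fun=> 0); rewrite raise0 addr0 => <-.
by congr raise; apply/funext => t; rewrite addr0.
Qed.

Definition raiseE (v : E) : E := fun w => raise w v.

Fact raiseE_linear : linear raiseE.
Proof. by move=> a u v; apply/funext => w; exact: raise_lin. Qed.
HB.instance Definition _ := GRing.isLinear.Build k E E *:%R raiseE raiseE_linear.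

Local Notation ad := (ad raiseE).
Local Notation Delta := (Delta raiseE).
Local Notation opmul := (opmul raiseE).

(** Left multiplication by the letter [(b, j)] on coefficient functions; its commutator with
    [raiseE] is left multiplication by the derived letter. *)
Definition letter_op (b : B) (j : nat) : E -> E := fun v w =>
  if w is x :: w' then if x == (b, j) then v w' else 0 else 0.

Lemma letter_op_linear b j : linear (letter_op b j).
Proof.
move=> a u v; apply/funext => -[|x w]; rewrite !fctE /=; first by rewrite scaler0 addr0.
by case: ifP => // _; rewrite scaler0 addr0.
Qed.

Lemma ad_letter_op b j : ad (letter_op b j) = if j is j'.+1 then letter_op b j' else 0.
Proof.
apply/funext => v; apply/funext => -[|[c i] w]; rewrite /ad !fctE /= /raiseE /=.
  by rewrite subr0; case: j.
have -> : raise w (fun t => if (c, i) == (b, j) then v t else 0) =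
    if (c, i) == (b, j) then raise w v else 0.
  by case: ifP => // _; exact: raise0.
rewrite addrK; case: j => [|j]; first by rewrite xpair_eqE andbF.
by rewrite /= !xpair_eqE eqSS.
Qed.

Definition gen_op (b : B) : nat -> E -> E := fun l => if l is 0 then letter_op b N.-1 else 0.

Lemma gen_op_linear b : op_linear (gen_op b).
Proof.
move=> [|l] a x y; first exact: letter_op_linear.
by change (0 = a *: 0 + 0 :> E); rewrite scaler0 addr0.
Qed.

Lemma gen_op_bounded b : op_bounded raiseE N (gen_op b).
Proof.
have H j i v : (i < j)%N -> iter j ad (letter_op b i) v = 0.
  elim: j i v => // j IH i v; rewrite iterSr ad_letter_op.
  by case: i => [|i] l; [rewrite iter_ad0 | exact: IH].
move=> [|i] j l v; first by apply: H; lia.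
by rewrite /= iter_ad0.
Qed.

Lemma gen_op_good b : op_good raiseE (gen_op b).
Proof. by split; [exact: gen_op_linear | exists N; exact: gen_op_bounded]. Qed.

Lemma opmul_gen_op n b g : opmul n (gen_op b) g =
  fun l v => letter_op b N.-1 (iter n Delta g l v).
Proof.
elim: n g => [//|n IH] g; rewrite opmulS -[shift _]/(0 : nat -> E -> E) opmul0l.
by rewrite IH -iterSr; apply: opE => l v; rewrite !fctE; exact: subr0.
Qed.

Lemma iter_Delta_eq0 M n f : op_bounded raiseE M f -> (M <= n)%N -> iter n Delta f = 0.
Proof.
move=> bf l; apply: (@op_bounded0 _ _ raiseE).
have -> : 0%N = (M - n)%N by lia.
elim: n {l} => [|n IH]; first by rewrite subn0.
by rewrite subnS; apply: op_bounded_Delta.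
Qed.

Definition gen_model b : op_conf raiseE := sub_conf_mk (op_good_conformal raiseE) (gen_op_good b).

Lemma gen_model_local : bounded_locality N gen_model.
Proof.
move=> a b n l; apply: (@sub_conf_inj _ _ _ _ _ (op_good_conformal raiseE)).
rewrite sub_conf_mul !sub_conf_mkK opmul_gen_op linear0.
apply: opE => i v; rewrite (iter_Delta_eq0 (gen_op_bounded b) l).
exact: (lin_0 (letter_op_linear a N.-1)).
Qed.

(** The unit of the free algebra. Applying a left multiplication operator to it recovers the element
    multiplied by, so [coef f l w] below is the coefficient of the monomial [w] at [D^l/l!]. *)
Definition empty_ind : E := fun w => (w == [::])%:R.
Definition coef (f : nat -> E -> E) (l : nat) (w : letters) : k := f l empty_ind w.
(** [Delta] read on coefficients: the derivation kills the unit, so its commutator with an operator,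
    applied to the unit, is the derivation of the value. *)
Definition Draise (g : nat -> letters -> k) (l : nat) (w : letters) : k :=
  raise w (g l) + g l.+1 w.

Lemma raise_empty_ind : raiseE empty_ind = 0.
Proof.
apply/funext => -[//|x w]; rewrite /raiseE /= /empty_ind /= add0r; exact: raise0.
Qed.

Lemma coef_iter_Delta n f : op_linear f -> coef (iter n Delta f) = iter n Draise (coef f).
Proof.
move=> lf; have li m : op_linear (iter m Delta f).
  by elim: m => //= m IH; exact: Delta_linear.
elim: n => [//|n IH]; rewrite !iterS -IH.
apply/funext => l; apply/funext => w.
transitivity (raise w (iter n Delta f l empty_ind) -
  iter n Delta f l (raiseE empty_ind) w + iter n Delta f l.+1 empty_ind w) => //.
rewrite raise_empty_ind (lin_0 (li n l)); congr (_ + _); exact: subr0.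
Qed.

Definition prefix_fun (b : B) (g : nat -> letters -> k) (l : nat) (w : letters) : k :=
  if w is x :: w' then if x == (b, N.-1) then g l w' else 0 else 0.

Lemma coef_opmul_gen n b g : op_linear g ->
  coef (opmul n (gen_op b) g) = prefix_fun b (iter n Draise (coef g)).
Proof.
by move=> lg; rewrite opmul_gen_op -coef_iter_Delta.
Qed.

(** The factor i! is the price of divided powers: [D^i] is i! times [D^i/i!]. *)
Lemma coef_iterD_gen i b : coef (iter i (@opD _ _) (gen_op b)) =
  prefix_fun b (fun l w => (i`! * (l == i) * (w == [::]))%:R).
Proof.
have h l v : iter i (@opD _ _) (gen_op b) l v = (i`! * (l == i))%:R *: letter_op b N.-1 v.
  elim: i l v => [|i IH] l v.
    rewrite fact0 mul1n; case: l => [|l] /=; first by rewrite scale1r.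
    by rewrite scale0r.
  rewrite iterS /opD IH; case: l => [|l]; first by rewrite muln0 !scale0r.
  rewrite scalerA -natrM eqSS factS /=; case: eqP => [->|_]; last by rewrite !muln0.
  by rewrite !muln1.
apply/funext => l; apply/funext => w; rewrite /coef h /prefix_fun !fctE.
case: w => [|x w] /=; first exact: mulr0.
by case: ifP => // _; [rewrite [RHS]natrM | exact: mulr0].
Qed.

Lemma iter_Draise_nil n g l : iter n Draise g l [::] = g (l + n)%N [::].
Proof.
elim: n l => [|n IH] l; first by rewrite addn0.
by rewrite iterS /Draise /= add0r IH addSnnS.
Qed.

(** By Leibniz, to become [x] the letter [(b, N.-1)] must absorb exactly [N.-1 - x.2] of the [n]
    derivations, chosen in a binomial number of ways; the others act on [g]. *)
Lemma iter_Draise_prefix n b g l x w :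
  iter n Draise (prefix_fun b g) l (x :: w) =
  if (x.1 == b) && (x.2 <= N.-1)%N
  then 'C(n, N.-1 - x.2)%:R * iter (n - (N.-1 - x.2)) Draise g l w else 0.
Proof.
elim: n l x w => [|n IH] l [c j] w.
  rewrite [LHS]/= xpair_eqE bin0n sub0n /=.
  case: eqP => //= _; have [jN|//|->] := ltngtP j N.-1; last by rewrite subnn mul1r.
  have -> : (N.-1 - j == 0)%N = false by lia.
  by rewrite mul0r.
rewrite iterS {1}/Draise /=.
have -> : (fun t => iter n Draise (prefix_fun b g) l ((c, j) :: t)) =
  (fun t => (if (c == b) && (j <= N.-1)%N then 'C(n, N.-1 - j)%:R else 0) *
     iter (n - (N.-1 - j)) Draise g l t).
  by apply/funext => t; rewrite IH /=; case: ifP => // _; rewrite mul0r.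
rewrite raiseZ !IH /=; case: eqP => /= _; last by rewrite !mul0r !addr0.
have [jN|jN|jN] := ltngtP j N.-1; last 2 first.
- by rewrite !mul0r !addr0.
- rewrite jN subnn !bin0 !subn0 add0r !mul1r iterS; reflexivity.
set m := (N.-1 - j.+1)%N; have -> : (N.-1 - j)%N = m.+1 by rewrite /m; lia.
rewrite subSS binS natrD.
have [mn|nm] := ltnP m n.
  have -> : (n - m = (n - m.+1).+1)%N by lia.
  by rewrite iterS -addrA -mulrDr mulrDl addrC.
by rewrite (@bin_small n m.+1) // !mul0r !addr0 add0r.
Qed.

Fixpoint word_coef (p : seq (B * 'I_N)) (b : B) (i : nat) : nat -> letters -> k :=
  if p is (c, n) :: p' then prefix_fun c (iter n Draise (word_coef p' b i))
  else prefix_fun b (fun l w => (i`! * (l == i) * (w == [::]))%:R).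

(* The leading monomial of the D-free word [q c]; [m] is the order of the
   derivative of its first letter. *)
Fixpoint word_enc (m : nat) (q : seq (B * 'I_N)) (c : B) : letters :=
  if q is (c', m') :: q' then (c', N.-1 - m)%N :: word_enc m' q' c
  else [:: (c, N.-1 - m)%N].

Lemma op_linear_val (x : op_conf raiseE) : op_linear (op_val raiseE x).
Proof. by have [] := sub_conf_valP x. Qed.

Lemma coef_nword (u : word B N) :
  coef (op_val raiseE (nword gen_model u)) = word_coef (wpre u) (wlast u) (wind u).
Proof.
case: u => [[p b] i]; rewrite /nword /wpre /wlast /wind /=.
elim: p => [|[c n] p IH] /=.
  rewrite -coef_iterD_gen; congr coef.
  by elim: i => [//|i IH]; rewrite !iterS -IH.
rewrite -IH -coef_opmul_gen //; exact: op_linear_val.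
Qed.

Lemma prefix_fun_enc n m b g l c w : (m < N)%N ->
  iter n Draise (prefix_fun b g) l ((c, N.-1 - m)%N :: w) =
  if c == b then 'C(n, m)%:R * iter (n - m) Draise g l w else 0.
Proof.
move=> mN; rewrite iter_Draise_prefix /= leq_subr andbT subKn //; lia.
Qed.

Lemma iter_Draise_rcons n g l x w : (forall l w, w != [::] -> g l w = 0) ->
  iter n Draise g l (x :: w) = 0.
Proof.
move=> h; elim: n l x w => [|n IH] l x w; first exact: h.
rewrite iterS /Draise /= !IH addr0 add0r.
have -> : (fun t => iter n Draise g l (x :: t)) = (fun=> 0) by apply/funext => t; exact: IH.
exact: raise0.
Qed.

(** At the word's own monomial every binomial is ['C(n, n) = 1], so the coefficient is i!, which is
    nonzero in characteristic 0. *)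
Lemma word_coef_diag p b i n (nN : (n < N)%N) :
  iter n Draise (word_coef p b i) i (word_enc n p b) != 0.
Proof.
have fact_neq0 : (i`!%:R : k) != 0.
  elim: (i) => [|j IH]; first by rewrite fact0 oner_neq0.
  by rewrite factS natrM mulf_neq0 // ((pcharf0P k).1 hk).
elim: p n nN => [|[c m] p IH] n nN /=; rewrite prefix_fun_enc // eqxx binn mul1r subnn.
  by rewrite /= eqxx !muln1.
exact: IH.
Qed.

(** A nonzero coefficient forces ['C(n, m) != 0], and the [n - m] derivations left over pass to the
    remaining letters. When [n = m] nothing is left over, so the next order [m1] is at most the
    index [n1]: a smaller one decides the comparison, equality continues the induction. *)
Lemma word_coef_triangular p b i q c l n m : (m < N)%N ->
  iter n Draise (word_coef p b i) l (word_enc m q c) != 0 ->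
  [/\ size p = size q, (m <= n)%N & n = m -> wle (q, c, l) (p, b, i)].
Proof.
elim: p q n m => [|[b1 n1] p IH] [|[c1 m1] q] n m mN /=; rewrite prefix_fun_enc //;
  case: ifP => [/eqP ->|_]; rewrite ?eqxx //.
- have [mn|nm] := leqP m n; last by rewrite bin_small // mul0r eqxx.
  move=> h; split => // e; subst n; move: h; rewrite subnn /= binn mul1r muln1.
  have [->|_] := eqVneq l i; last by rewrite muln0 eqxx.
  by move=> _; exact: wle_refl.
- by case: q => [|[? ?] q]; rewrite /= iter_Draise_rcons ?mulr0 ?eqxx // => l' [|x w'] //= _;
    rewrite muln0.
- by case: p IH => [|[? ?] p] IH; rewrite -iterD iter_Draise_nil ?mulr0 ?eqxx.
- have [mn|nm] := leqP m n; last by rewrite bin_small // mul0r eqxx.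
  rewrite mulf_eq0 negb_or -iterD => /andP[_ /IH [//|e1 e2 e3]].
  split => //; first by rewrite e1.
  move=> e; subst n; rewrite subnn add0n in e2 e3.
  have el : wlen (q, c, l) = wlen (p, b, i) by rewrite /wlen /wpre /= e1.
  rewrite -[((b1, m1) :: q, c, l)]/(wctx [:: (b1, m1)] (q, c, l)).
  rewrite -[((b1, n1) :: p, b, i)]/(wctx [:: (b1, n1)] (p, b, i)).
  move: e2; rewrite leq_eqVlt => /predU1P[e2|e2]; last first.
    by apply: wltW; apply: wlt_cons_lt; [exact: ltB_index | rewrite el].
  have -> : m1 = n1 by apply: val_inj.
  by rewrite wle_wctx; exact: e3.
Qed.

End WordModel.

(** * Linear independence by triangularity *)

Section Independence.
Context (k : fieldType) (hk : [pchar k]%R =i pred0).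
Context (disp : Order.disp_t) (B : orderType disp) (N : nat).

Definition independent (M : lmodType k) (W : eqType) (v : W -> M) :=
  forall (s : seq W) (c : W -> k), uniq s ->
    \sum_(w <- s) c w *: v w = 0 -> {in s, forall w, c w = 0}.

Lemma seq_max_word (s : seq (word B N)) : s != [::] ->
  exists2 u, u \in s & {in s, forall v, wle v u}.
Proof.
elim: s => // u [|u' s] IH _.
  by exists u; rewrite ?mem_head // => v; rewrite inE => /eqP ->; exact: wle_refl.
have [//|w ws wmax] := IH.
have [uw|wu] := boolP (wle u w).
  exists w; first by rewrite inE ws orbT.
  by move=> v; rewrite inE => /predU1P[->//|/wmax].
exists u; first exact: mem_head.
have {}wu : wle w u by move: (wle_total u w); rewrite (negbTE wu).
move=> v; rewrite inE => /predU1P[->|/wmax vw]; first exact: wle_refl.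
exact: wle_trans vw wu.
Qed.

(** A relation is tested with the functional of its largest word having a nonzero coefficient; that
    word alone contributes. *)
Lemma triangular_independent (M : lmodType k) (v : word B N -> M)
    (ev : word B N -> {linear M -> k^o}) :
  (forall u, ev u (v u) != 0) -> (forall u w, ev u (v w) != 0 -> wle u w) ->
  independent v.
Proof.
move=> diag tri s c us e.
pose s' := [seq w <- s | c w != 0].
have [s0|/seq_max_word[u us' umax]] := eqVneq s' [::].
  move=> w ws; apply/eqP; apply: contraT => cw.
  have : w \in s' by rewrite mem_filter cw.
  by rewrite s0.
move: (us'); rewrite mem_filter => /andP[cu ius].
have := congr1 (ev u) e; rewrite linear_sum linear0 (bigD1_seq u) //= big1_seq.
  rewrite addr0 linearZ => /eqP; rewrite mulf_eq0 (negbTE cu) /=.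
  by rewrite (negbTE (diag u)).
move=> w /andP[wu ws]; rewrite linearZ.
have [->|cw] := eqVneq (c w) 0; first exact: mul0r.
have [->|ew] := eqVneq (ev u (v w)) 0; first exact: mulr0.
have uw := tri _ _ ew; have wu' : wle w u by apply: umax; rewrite mem_filter cw.
have : wlt w u by rewrite wlt_neqAle wu wu'.
by rewrite wltNge uw.
Qed.

Lemma conf_hom_nword (C C' : conformalAlg k) (gen : B -> C) (gen' : B -> C')
    (phi : {linear C -> C'}) :
  conf_hom phi -> (forall b, phi (gen b) = gen' b) ->
  forall u : word B N, phi (nword gen u) = nword gen' u.
Proof.
move=> [hD hm] hg [[p b] i]; rewrite /nword /wpre /wlast /wind /=.
elim: p => [|[c n] p IH] /=; last by rewrite hm hg IH.
elim: i => [|i IH]; first exact: hg.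
by rewrite !iterS hD IH.
Qed.

End Independence.

(* For N = 0 the letters (b, N - 1) above make no sense, but then all products
   may be taken to vanish. *)
Section ZeroProducts.
Context (k : fieldType) (disp : Order.disp_t) (B : orderType disp).
Local Notation X := (nat -> B -> k^o).

Definition shiftD (f : X) : X := fun l b => if l is l'.+1 then f l' b else 0.

Fact shiftD_linear : linear shiftD.
Proof.
move=> a x y; apply/funext => -[|l]; apply/funext => b; rewrite !fctE //=.
by rewrite scaler0 addr0.
Qed.
HB.instance Definition _ := GRing.isLinear.Build k X X *:%R shiftD shiftD_linear.

Definition zero_mul (_ : nat) (_ _ : X) : X := 0.

Definition zero_conf : conformalAlg k.
Proof.
refine (@ConformalAlg k X shiftD zero_mul _ _ _ _ _ _) => //.
- by move=> n b a x y; rewrite /zero_mul scaler0 addr0.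
- by move=> n b a x y; rewrite /zero_mul scaler0 addr0.
- by exists 0%N.
- by move=> n a b; rewrite /zero_mul linear0 addr0.
- by move=> n a b; rewrite /zero_mul scaler0 oppr0.
Defined.

Definition zero_gen (b : B) : zero_conf := fun l c => ((l == 0%N) && (c == b))%:R.

Lemma zero_conf_assoc : conf_assoc zero_conf.
Proof.
move=> n m a b c; rewrite /cmul /= /zero_mul big1 // => i _; exact: scaler0.
Qed.

Lemma zero_gen_iterD i b : iter i (cD zero_conf) (zero_gen b) =
  (fun l c => ((l == i) && (c == b))%:R) :> X.
Proof.
elim: i => [//|i IH]; rewrite iterS IH; apply/funext => -[|l] //.
Qed.

Definition zero_at l b (f : zero_conf) : k^o := (f : X) l b.
Fact zero_at_linear l b : linear (zero_at l b). Proof. by []. Qed.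
HB.instance Definition _ l b :=
  GRing.isLinear.Build k zero_conf k^o *:%R (zero_at l b) (zero_at_linear l b).

End ZeroProducts.

(** * The normal words form a basis of the free conformal algebra *)

Section FreeConformal.
Context (k : fieldType) (hk : [pchar k]%R =i pred0).
Context (disp : Order.disp_t) (B : orderType disp) (N : nat).
Context (C : conformalAlg k) (gen : B -> C) (hC : is_free_conf N gen).

Definition coef_at l w (f : nat -> (seq (B * nat) -> k^o) -> seq (B * nat) -> k^o) : k^o :=
  coef f l w.
Fact coef_at_linear l w : linear (coef_at l w). Proof. by []. Qed.
HB.instance Definition _ l w :=
  GRing.isLinear.Build k _ k^o *:%R (coef_at l w) (coef_at_linear l w).

Lemma nword_independent : independent (fun u : word B N => nword gen u).
Proof.
have [hA hN hU] := hC.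
have [N0|N0] := posnP N.
  have hz : bounded_locality N (@zero_gen k _ B) by [].
  have [phi [hom hg _]] := hU _ _ (@zero_conf_assoc k _ B) hz.
  (* No index is below [N = 0], so the only words are the [D^i b]. *)
  have pre0 (u : word B N) : wpre u = [::].
    by case: u => [[[|[b [n nN]] p] c] i] //; exfalso; move: nN; rewrite N0.
  have e (u w : word B N) : zero_at (wind u) (wlast u) (phi (nword gen w)) =
      ((wind u == wind w) && (wlast u == wlast w))%:R.
    rewrite (conf_hom_nword hom hg) /nword pre0 /zero_at /=.
    by rewrite zero_gen_iterD.
  apply: (triangular_independent
    (ev := fun u => zero_at (wind u) (wlast u) \o phi)) => [u|u w] /=.
    by rewrite e !eqxx oner_neq0.
  rewrite e; have [e1|_] := eqVneq (wind u) (wind w); last by rewrite eqxx.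
  have [e2|_] := eqVneq (wlast u) (wlast w); last by rewrite eqxx.
  move=> _; have -> : u = w; last exact: wle_refl.
  move: (pre0 u) (pre0 w) e1 e2; case: u w => [[p b] i] [[q c] j].
  by rewrite /wpre /wind /wlast /= => -> -> -> ->.
have hl := @gen_model_local k disp B N N0.
have [phi [hom hg _]] := hU _ _ (@op_conf_assoc _ _ _) hl.
have e (u w : word B N) : coef_at (wind u) (word_enc 0%N (wpre u) (wlast u))
    (op_val _ (phi (nword gen w))) =
    word_coef k (wpre w) (wlast w) (wind w) (wind u) (word_enc 0%N (wpre u) (wlast u)).
  by rewrite (conf_hom_nword hom hg) /coef_at coef_nword.
apply: (triangular_independent (ev := fun u =>
  coef_at (wind u) (word_enc 0%N (wpre u) (wlast u)) \o (op_val _ \o phi))) => [u|u w] /=.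
  rewrite e; exact: (@word_coef_diag _ hk _ _ _ N0 _ _ _ 0%N N0).
rewrite -[X in X != 0 -> _]/(coef_at _ _ (op_val _ _)) e => h.
case: u w {e} h => [[q c] l] [[p b] i] h.
by case: (@word_coef_triangular k _ _ _ N0 p b i q c l 0%N 0%N N0 h) => _ _; apply.
Qed.

Lemma nword_span x : wspan (@is_nword k disp B N C gen) setT x.
Proof.
have [hA hN hU] := hC.
set P := wspan _ _.
have sP : subspace P := wspan_subspace _ _.
have PD y : P y -> P (cD C y) by apply: D_wspan (W_D (gen := gen)) _ _ _ _.
have Pm n y z : P y -> P z -> P (cmul n y z).
  move=> Py Pz; move: y Py; apply: wspan_min.
    exact: subspace_cmull.
  move=> _ u -> _; move: z Pz; apply: wspan_min.
    exact: subspace_cmulr.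
  by move=> _ w -> _; apply: wspan_mono (cmul_words hA hN u n w).
have H : conformal_on P (cD C) (@cmul k C).
  split=> //.
  - by move=> a y z _ _; exact: linearP.
  - by move=> n z a y y' _ _ _; exact: cmul_linearl.
  - by move=> n z a y y' _ _ _; exact: cmul_linearr.
  - by move=> y z _ _; exact: cmul_local.
  - by move=> n y z _ _; exact: cD_cmul.
  - by move=> y z _ _; exact: cmul0_D.
  - by move=> n y z _ _; exact: cmulS_D.
have Pg b : P (gen b) by apply: (@W_word _ _ _ _ _ _ _ ([::], b, 0%N)).
pose gen' b : sub_conf H := sub_conf_mk H (Pg b).
have hA' : conf_assoc (sub_conf H).
  move=> n m a b c; apply: (@sub_conf_inj _ _ _ _ _ H).
  rewrite linear_sum; under eq_bigr do rewrite linearZ; exact: hA.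
have hN' : bounded_locality N gen'.
  by move=> a b n /hN e; apply: (@sub_conf_inj _ _ _ _ _ H); rewrite sub_conf_mul e linear0.
have [phi [[hD hm] hg _]] := hU _ _ hA' hN'.
have [psi [_ _ uniq]] := hU _ _ hA hN.
(* The map into the span followed by the inclusion extends [gen], as does the identity; by
   uniqueness they agree, so [x] lies in the span. *)
pose theta : {linear C -> C} := sub_conf_val H \o phi.
have e1 : theta =1 psi.
  apply: uniq; last by move=> b; rewrite /= hg.
  by split=> [a|n a b]; rewrite /= ?hD ?hm.
have e2 : (idfun : {linear C -> C}) =1 psi by apply: uniq.
by rewrite -[x]/(idfun x) e2 -e1; exact: sub_conf_valP.
Qed.

End FreeConformal.

(** * Leading words *)

Section LeadingWords.
Context (k : fieldType) (hk : [pchar k]%R =i pred0).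
Context (disp : Order.disp_t) (B : orderType disp) (N : nat).
Context (C : conformalAlg k) (gen : B -> C) (hC : is_free_conf N gen).
Local Notation D := (cD C).
Local Notation word := (word B N).
Local Notation W := (wspan (@is_nword k disp B N C gen)).
Local Notation lact := (@lact k disp B N C gen).
Implicit Types (u v w c : word) (P : set word) (f g x y : C).

Let hA : conf_assoc C. Proof. by case: hC. Qed.
Let hN : bounded_locality N gen. Proof. by case: hC. Qed.

(** The form of [lead_term] that avoids lists of coefficients and fits the span lemmas; [lead_termE]
    identifies the two. *)
Definition has_lead f (al : k) w := al != 0 /\ W [set u | wlt u w] (f - al *: nword gen w).
Definition monic_lead f w := W [set u | wlt u w] (f - nword gen w).

Lemma monic_has_lead f w : monic_lead f w -> has_lead f 1 w.
Proof. by split; [exact: oner_neq0 | rewrite scale1r]. Qed.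

Lemma wspan_seq P f : W P f -> exists s (c : word -> k),
  [/\ uniq s, {in s, forall u, P u} & f = \sum_(u <- s) c u *: nword gen u].
Proof.
elim=> [|a _ y [u -> Pu] _ [s [c [us Ps ->]]]].
  by exists [::], (fun=> 0); rewrite big_nil.
have [ius|nus] := boolP (u \in s).
  exists s, (fun v => c v + (v == u)%:R * a); split => //.
  under [in RHS]eq_bigr do rewrite scalerDl; rewrite big_split /= addrC; congr (_ + _).
  rewrite (bigD1_seq u) //= eqxx mul1r big1 ?addr0 // => v /negbTE ->.
  by rewrite mul0r scale0r.
exists (u :: s), (fun v => if v == u then a else c v); split => /=.
- by rewrite nus.
- by move=> v; rewrite inE => /predU1P[->//|/Ps].
rewrite big_cons eqxx; congr (_ + _); apply: eq_big_seq => v vs.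
by case: eqP => // e; move: nus; rewrite -e vs.
Qed.

(** Independence of the normal words in usable form: the leading word cannot cancel, so it must be
    among the words allowed. With [P] empty this says that [f] is not 0. *)
Lemma has_lead_in P f al w : has_lead f al w -> W P f -> P w.
Proof.
move=> [al0 h] hf; apply: contrapT => nPw; move: al0; apply/negP; rewrite negbK.
have : W [set u | u <> w] (al *: nword gen w).
  have -> : al *: nword gen w = f - (f - al *: nword gen w) by rewrite opprB addrC subrK.
  apply: subspaceB; first exact: wspan_subspace.
    by apply: wspan_mono hf => u Pu e; apply: nPw; rewrite -e.
  by apply: wspan_mono h => u /= uw e; move: uw; rewrite e wlt_irr.
move=> /wspan_seq[s [c [us sw e]]].
have nws : w \notin s by apply/negP => /sw.
have := @nword_independent k hk disp B N C gen hC (w :: s)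
  (fun v => if v == w then - al else c v).
rewrite /= nws us big_cons eqxx => /(_ isT) h'.
have : - al *: nword gen w + \sum_(j <- s) (if j == w then - al else c j) *: nword gen j = 0.
  rewrite scaleNr e addrC; apply/eqP; rewrite subr_eq0; apply/eqP.
  apply: eq_big_seq => v vs; case: eqP => // ev; move: nws; rewrite -ev vs //.
by move/h' => /(_ w (mem_head _ _)); rewrite eqxx => /eqP; rewrite oppr_eq0.
Qed.

Lemma has_lead_uniq f al al' w w' : has_lead f al w -> has_lead f al' w' -> w = w'.
Proof.
have le g b v : has_lead g b v -> W [set u | wle u v] g.
  move=> [_ h]; apply: (subspaceBl (wspan_subspace _ _)).
    by apply: wspan_mono h => u /wltW.
  apply: subspaceZ; first exact: wspan_subspace.
  by apply: W_word; exact: wle_refl.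
move=> h h'; have := has_lead_in h (le _ _ _ h'); rewrite /= wle_eqVlt => /predU1P[//|l].
have := has_lead_in h' (le _ _ _ h); rewrite /= wleNgt l //.
Qed.

Lemma has_lead_exists P f : f <> 0 -> W P f -> exists al w, P w /\ has_lead f al w.
Proof.
move=> f0 /wspan_seq[s [c [us Ps e]]].
pose s' := [seq u <- s | c u != 0].
have ef : f = \sum_(u <- s') c u *: nword gen u.
  rewrite big_filter e [RHS]big_mkcond; apply: eq_bigr => u _.
  by case: eqP => //= ->; rewrite scale0r.
have us' : uniq s' by rewrite filter_uniq.
have [s0|/seq_max_word[w ws wmax]] := eqVneq s' [::].
  by case: f0; rewrite ef s0 big_nil.
move: (ws); rewrite mem_filter => /andP[cw ws0].
exists (c w), w; split; first exact: Ps.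
split=> //; rewrite ef (bigD1_seq w) //= addrAC subrr add0r -big_filter.
apply: subspace_sum; first exact: wspan_subspace.
move=> u; rewrite mem_filter => /andP[uw us2].
apply: subspaceZ; first exact: wspan_subspace.
by apply: W_word; rewrite /= wlt_neqAle uw wmax.
Qed.

Lemma unzip2_inj (e : seq (k * word)) a b w :
  uniq (unzip2 e) -> (a, w) \in e -> (b, w) \in e -> a = b.
Proof.
elim: e => //= -[c u] e IH /andP[ue une]; rewrite !inE.
move=> /predU1P[[e1 e2]|ae] /predU1P[[e3 e4]|be].
- by rewrite e1 e3.
- by case/negP: ue; rewrite -e2; apply/mapP; exists (b, w).
- by case/negP: ue; rewrite -e4; apply/mapP; exists (a, w).
- exact: IH.
Qed.

Lemma lead_termE f al w : lead_term gen f al w <-> has_lead f al w.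
Proof.
split=> [[e [[ue e0 ->] ew emax]]|[al0 /wspan_seq[s [c [us sw e]]]]].
  split; first exact: (e0 _ ew).
  rewrite (bigD1_seq (al, w)) //=; last exact: map_uniq ue.
  rewrite addrAC subrr add0r -big_filter.
  apply: subspace_sum; first exact: wspan_subspace.
  move=> [b u]; rewrite mem_filter => /andP[ne ie].
  apply: subspaceZ; first exact: wspan_subspace.
  apply: W_word => /=; rewrite wlt_neqAle emax ?andbT; last by apply/mapP; exists (b, u).
  apply: contraNneq ne => euw; subst u; apply/eqP.
  by congr pair; exact: unzip2_inj ue ie ew.
pose s' := [seq u <- s | c u != 0].
exists ((al, w) :: [seq (c u, u) | u <- s']).
have e2 : unzip2 [seq (c u, u) | u <- s'] = s' by rewrite /unzip2 -map_comp map_id.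
have lt u : u \in s' -> wlt u w by rewrite mem_filter => /andP[_ /sw].
split; last first.
- by rewrite /= e2 => v; rewrite inE => /predU1P[->|/lt /wltW //]; exact: wle_refl.
- exact: mem_head.
split.
- rewrite /= e2 filter_uniq // andbT; apply/negP => /lt; by rewrite wlt_irr.
- move=> x; rewrite inE => /predU1P[->//|/mapP[u]].
  by rewrite mem_filter => /andP[cu _] ->.
rewrite big_cons big_map big_filter addrC -[f](subrK (al *: nword gen w)) e.
congr (_ + _); rewrite [RHS]big_mkcond; apply: eq_bigr => u _ /=.
by case: eqP => //= ->; rewrite scale0r.
Qed.

Lemma bar_has_lead f al w : has_lead f al w -> bar N gen f = Some w.
Proof.
move=> h; rewrite /bar; case: xgetP => [x _ /= hx|/(_ (Some w))]; last first.
  by case; exists al; apply/lead_termE.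
case: x hx => [u [be /lead_termE h']|f0]; first by rewrite (has_lead_uniq h h').
by case: (has_lead_in h (P := set0)); rewrite f0; exact: subspace0 (wspan_subspace _ _).
Qed.

Lemma bar_eqNone : bar N gen (0 : C) = None.
Proof.
rewrite /bar; case: xgetP => [[w|] _ //=|//] [al /lead_termE h].
by case: (has_lead_in h (P := set0)); exact: subspace0 (wspan_subspace _ _).
Qed.

Lemma bar_Some f w : bar N gen f = Some w -> exists al, has_lead f al w.
Proof.
have [->|/eqP f0] := eqVneq f 0; first by rewrite bar_eqNone.
have [al [v [_ h]]] := has_lead_exists f0 (nword_span hC f).
by rewrite (bar_has_lead h) => -[<-]; exists al.
Qed.

Lemma bar_neq0 f : f <> 0 -> exists al w, has_lead f al w.
Proof.
by move=> /has_lead_exists /(_ (nword_span hC f)) [al [w [_ h]]]; exists al, w.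
Qed.

Lemma conf_monicE f : conf_monic N gen f <-> exists w, monic_lead f w.
Proof.
split=> -[w h]; exists w.
  by have [_] := (lead_termE f 1 w).1 h; rewrite scale1r.
by apply/lead_termE; exact: monic_has_lead.
Qed.

Lemma bar_monic f w : monic_lead f w -> bar N gen f = Some w.
Proof. by move/monic_has_lead/bar_has_lead. Qed.

Lemma monic_wle f w : monic_lead f w -> W [set u | wle u w] f.
Proof.
move=> h; apply: (subspaceBl (wspan_subspace _ _)).
  by apply: wspan_mono h => u /wltW.
by apply: W_word; exact: wle_refl.
Qed.

Lemma monic_sub f g w : monic_lead f w -> monic_lead g w -> W [set u | wlt u w] (f - g).
Proof.
move=> hf hg; apply: (subspaceBB (wspan_subspace _ _) hf).
exact: (subspaceBC (wspan_subspace _ _) hg).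
Qed.

Lemma monic_lact p f w : monic_lead f w -> monic_lead (lact p f) (wctx p w).
Proof.
move=> h; rewrite /monic_lead nword_wctx -linearB.
by apply: lact_wspan h; [exact: W_ctx | move=> u /=; rewrite wlt_wctx].
Qed.

Lemma iterDB i f g : iter i D (f - g) = iter i D f - iter i D g.
Proof. exact: (lin_sub _ _ (iterD_linear (C := C) i)). Qed.

Lemma monic_iterD i f w : monic_lead f w -> monic_lead (iter i D f) (wD w i).
Proof.
move=> h; apply: (subspaceBB (wspan_subspace _ _) (y := iter i D (nword gen w))).
  rewrite -iterDB; apply: iterD_wspan_lt h; exact: W_D.
exact: iterD_word.
Qed.

Lemma W_cmul v f n c : W [set u | wle u v] f -> W (V v (wlen c)) (cmul n f (nword gen c)).
Proof.
move: f; apply: wspan_min.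
  exact: subspace_cmull (wspan_subspace _ _).
move=> _ u -> uv; apply: wspan_mono (cmul_words hA hN u n c) => t; exact: V_mono.
Qed.

(** The words [u < v] of [f] need not be D-free, so the leading words of their products with [[c]]
    need not be concatenations; membership in [V u] is what places them below [wcat v m c]. *)
Lemma monic_cmul f v (m : 'I_N) c : monic_lead f v -> dfree v ->
  monic_lead (cmul m f (nword gen c)) (wcat v m c).
Proof.
move=> h dv; apply: (subspaceBB (wspan_subspace _ _) (y := cmul m (nword gen v) (nword gen c))).
  rewrite -cmulBl; move: h; rewrite /monic_lead; move: (f - _); apply: wspan_min.
    exact: subspace_cmull (wspan_subspace _ _).
  move=> _ u -> uv; apply: wspan_mono (cmul_words hA hN u m c) => t; exact: wlt_V.
exact: cmul_words_lead.
Qed.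

End LeadingWords.

(** * Normal S-words and compositions *)

Section NormalSWords.
Context (k : fieldType) (hk : [pchar k]%R =i pred0).
Context (disp : Order.disp_t) (B : orderType disp) (N : nat).
Context (C : conformalAlg k) (gen : B -> C) (hC : is_free_conf N gen).
Context (S : set C) (hS : forall s, S s -> conf_monic N gen s).
Local Notation D := (cD C).
Local Notation word := (word B N).
Local Notation W := (wspan (@is_nword k disp B N C gen)).
Local Notation lact := (@lact k disp B N C gen).
Local Notation nword := (@nword k disp B N C gen).
Local Notation monic_lead := (@monic_lead k disp B N C gen).
Local Notation bar := (@bar k disp B N C gen).
Implicit Types (u v w c : word) (P : set word) (f g x y z s : C).

Let hA : conf_assoc C. Proof. by case: hC. Qed.
Let hN : bounded_locality N gen. Proof. by case: hC. Qed.

(** The second argument is the leading word read off the shape, as [nsw_monic] confirms. Carrying it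
    along avoids the choice hidden in [bar]. *)
Inductive nsw : C -> word -> Prop :=
| Nsw1 p s sb (m : 'I_N) c : S s -> monic_lead s sb -> dfree sb ->
    nsw (lact p (cmul m s (nword c))) (wctx p (wcat sb m c))
| Nsw2 p s sb i : S s -> monic_lead s sb ->
    nsw (lact p (iter i D s)) (wctx p (wD sb i)).
Local Notation SW := (wspan nsw).

Lemma monicS s : S s -> exists sb, monic_lead s sb.
Proof. by move/hS/conf_monicE; apply. Qed.

Lemma nsw_monic x w : nsw x w -> monic_lead x w.
Proof.
by case=> *; apply: monic_lact; [apply: monic_cmul | apply: monic_iterD].
Qed.

Lemma nsw_bar x w : nsw x w -> bar x = Some w.
Proof. by move/nsw_monic/bar_monic; apply. Qed.

Lemma normal_SwordE x : normal_Sword N gen S x <-> exists w, nsw x w.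
Proof.
split=> [|[w]] [].
- move=> p s sb m c Ss bs ds; have [w h] := monicS Ss.
  move: bs; rewrite (bar_monic hk hC h) => -[e]; subst w.
  by exists (wctx p (wcat sb m c)); apply: Nsw1.
- by move=> p s i Ss; have [w h] := monicS Ss; exists (wctx p (wD w i)); apply: Nsw2.
- move=> p s sb m c Ss h ds; apply: NormalSword1 ds => //; exact: bar_monic.
- by move=> p s sb i Ss _; apply: NormalSword2.
Qed.

Lemma nsw_S s sb : S s -> monic_lead s sb -> nsw s sb.
Proof.
move=> Ss h; rewrite -(wD0 sb); have := @Nsw2 [::] s sb 0 Ss h.
by case: sb {h} => [[? ?] ?].
Qed.

Lemma nsw_S1 s sb (m : 'I_N) c : S s -> monic_lead s sb -> dfree sb ->
  nsw (cmul m s (nword c)) (wcat sb m c).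
Proof. by move=> Ss h ds; exact: (@Nsw1 [::] s sb m c). Qed.

Lemma nsw_S2 s sb i : S s -> monic_lead s sb -> nsw (iter i D s) (wD sb i).
Proof. by move=> Ss h; exact: (@Nsw2 [::] s sb i). Qed.

Lemma nsw_ctx b (n : 'I_N) x w : nsw x w -> nsw (cmul n (gen b) x) (wctx [:: (b, n)] w).
Proof.
case=> [p s sb m c Ss h ds|p s sb i Ss h]; rewrite -wctx_cat.
  exact: (@Nsw1 ((b, n) :: p)).
exact: (@Nsw2 ((b, n) :: p)).
Qed.

Lemma cmulS_wspan P P' s sb (m : 'I_N) z : S s -> monic_lead s sb -> dfree sb ->
  (forall u, P u -> P' (wcat sb m u)) -> W P z -> SW P' (cmul m s z).
Proof.
move=> Ss h ds PP'; move: z; apply: wspan_min; first exact: subspace_cmulr (wspan_subspace _ _).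
by move=> _ u -> /PP' Pu; apply: wspan_gen Pu; exact: nsw_S1.
Qed.

(** The difference is [(D s)_(m) [c]], which is 0 or a multiple of the normal S-word with index
    [m - 1]. *)
Lemma cD_cmulS s sb (m : 'I_N) c : S s -> monic_lead s sb -> dfree sb ->
  SW [set u | wlt u (wcat sb m c)] (D (cmul m s (nword c)) - cmul m s (D (nword c))).
Proof.
move=> Ss h ds; apply: cD_cmul_sub; first exact: wspan_subspace.
move=> n' n'm; have n'N := ltn_trans n'm (ltn_ord m).
apply: (wspan_gen (nsw_S1 (Ordinal n'N) c Ss h ds)).
exact: wlt_wcat_index.
Qed.

Lemma nsw_D x w : nsw x w -> SW [set u : word | wle u (wD w 1)] (D x).
Proof.
have H p y v : nsw y v -> SW [set u : word | wle u (wD v 1)] (D y) ->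
    SW [set u : word | wle u (wD (wctx p v) 1)] (D (lact p y)).
  move=> hy hDy; apply: (subspaceBl (wspan_subspace _ _) (y := lact p (D y))).
    have hl : SW [set u : word | (wlen u <= wlen v)%N] y.
      by apply: wspan_gen hy _; exact: leqnn.
    apply: wspan_mono (cD_lact nsw_ctx p hl _).2 => [u /= /wltW h|].
      exact: wle_trans h (wle_wDr _ _).
    by apply: wspan_mono hDy => u /wle_wlen.
  by apply: (lact_wspan nsw_ctx) hDy => u /=; rewrite -wctx_wD wle_wctx.
case=> [p s sb m c Ss h ds|p s sb i Ss h]; apply: H.
- exact: nsw_S1.
- apply: (subspaceBl (wspan_subspace _ _)).
    apply: wspan_mono (cD_cmulS m c Ss h ds) => u /= /wltW h'.
    exact: wle_trans h' (wle_wDr _ _).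
  apply: (cmulS_wspan Ss h ds) (W_D (erefl (nword c))) => u /=.
  by rewrite !wleNgt -wcat_wD wlt_wcatr.
- exact: nsw_S2.
- apply: (@wspan_gen _ _ _ _ _ _ (wD sb i.+1)); first exact: (@nsw_S2 s sb i.+1).
  by rewrite /= wD_add addn1; exact: wle_refl.
Qed.

Lemma iterD_cmulS i s sb (m : 'I_N) c : S s -> monic_lead s sb -> dfree sb ->
  SW [set u | wlt u (wcat sb m (wD c i))]
    (iter i D (cmul m s (nword c)) - cmul m s (nword (wD c i))).
Proof.
move=> Ss h ds; elim: i => [|i IH].
  by rewrite wD0 subrr; apply: subspace0; exact: wspan_subspace.
apply: (subspaceBB (wspan_subspace _ _) (y := D (cmul m s (nword (wD c i))))).
  rewrite iterS -linearB; have := iterD_wspan_lt nsw_D 1 IH.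
  by rewrite -wcat_wD wD_add addn1.
have lt1 : wle (wD c i) (wD c i.+1) by rewrite -[i.+1]addn1 -wD_add wle_wDr.
apply: (subspaceBB (wspan_subspace _ _) (y := cmul m s (D (nword (wD c i))))).
  apply: wspan_mono (cD_cmulS m (wD c i) Ss h ds) => u /= h'.
  by apply: wlt_le_trans h' _; rewrite wleNgt wlt_wcatr -wleNgt.
have := cD_nword gen (wD c i); rewrite wD_add addn1 => hD.
rewrite -linearB; apply: (cmulS_wspan Ss h ds) hD => u /= h'.
by rewrite wlt_wcatr; apply: wlt_le_trans h' lt1.
Qed.

(** Moving the bracket produces terms with a smaller index after [s], still normal S-words; then
    [[v]_(n) [c]] is replaced by its leading normal word. *)
Lemma cmul_cmulS s sb (m n : 'I_N) v c : S s -> monic_lead s sb -> dfree sb -> dfree v ->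
  SW [set u | wlt u (wcat sb m (wcat v n c))]
    (cmul n (cmul m s (nword v)) (nword c) - cmul m s (nword (wcat v n c))).
Proof.
move=> Ss h ds dv.
apply: (subspaceBB (wspan_subspace _ _) (y := cmul m s (cmul n (nword v) (nword c)))).
  apply: assoc_sub_lead => //; first exact: wspan_subspace.
  move=> n' m' n'm; apply: (cmulS_wspan (m := Ordinal (ltn_trans n'm (ltn_ord m))) Ss h ds)
    (cmul_words hA hN v m' c) => u [l _].
  by apply: wlt_wcat_index => //; rewrite wlen_wcat.
rewrite -linearB; apply: (cmulS_wspan Ss h ds) (cmul_words_lead hA hN n c dv) => u /= h'.
by rewrite wlt_wcatr.
Qed.

(** * Products of normal S-words with normal words when compositions are trivial *)

Section Composition.
Hypothesis GS : GS_basis N gen S.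

(** The leading word of [h] lies in [P], since it cannot cancel; the terms given by triviality lie
    below it, and [P] is closed downwards. *)
Lemma composition_span P h : (forall u v, P u -> wle v u -> P v) ->
  composition N gen S h -> W P h -> SW P h.
Proof.
move=> Pdown /GS[e [e1 e2 eh]] Wh; rewrite eh; apply: subspace_sum; first exact: wspan_subspace.
move=> [a x] xe; apply: subspaceZ; first exact: wspan_subspace.
have /normal_SwordE[w hx] := e1 _ xe; have := e2 _ xe; rewrite /= (nsw_bar hx).
case eb : (Defs.bar _ _ _) => [v|//] wv.
have [al hv] := bar_Some hk hC eb.
have Pv : P v := has_lead_in hk hC hv Wh.
apply: wspan_gen hx _; exact: (Pdown v w Pv wv).
Qed.

Lemma composition_span_lt f g w : composition N gen S (f - g) ->
  monic_lead f w -> monic_lead g w -> SW [set u | wlt u w] (f - g).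
Proof.
move=> hc hf hg; apply: composition_span hc (monic_sub hf hg) => u v /= h h'.
exact: wle_lt_trans h' h.
Qed.

(** Stated for the elements of [S] alone so that it can serve as induction hypothesis on [c];
    [right_closed_nsw] extends it to all normal S-words. *)
Definition right_closed c := forall s sb n, S s -> monic_lead s sb ->
  SW (V sb (wlen c)) (cmul n s (nword c)).

Lemma V_ctx p v e u : V v e u -> V (wctx p v) e (wctx p u).
Proof.
move=> h; elim: p => [|[b n] p IH]; first by case: u v h => [[? ?] ?] [[? ?] ?].
by rewrite -cat1s !wctx_cat; apply: V_cons.
Qed.

Lemma V_wcat sb (m m' : 'I_N) c e u : (m' <= m)%N -> V c e u ->
  V (wcat sb m c) e (wcat sb m' u).
Proof.
move=> mm h; rewrite /wcat -!cats1 !wctx_cat; apply: V_ctx; exact: V_cons.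
Qed.

Lemma lact_cmul_V p y v e z : (forall n, SW (V v e) (cmul n y z)) ->
  forall n, SW (V (wctx p v) e) (cmul n (lact p y) z).
Proof.
move=> h; elim: p => [|[b j] p IH] n; first by move: (h n); case: (v) => [[? ?] ?].
apply: assoc_sub => //; first exact: wspan_subspace.
move=> n' m' l; apply: (cmul_wspan nsw_ctx (n := Ordinal (leq_ltn_trans l (ltn_ord j)))) (IH m').
by move=> u; rewrite -cat1s wctx_cat; apply: V_cons.
Qed.

Lemma right_closed_nsw c x w n : right_closed c -> nsw x w ->
  SW (V w (wlen c)) (cmul n x (nword c)).
Proof.
move=> hc; case=> [p s sb m c0 Ss h ds|p s sb i Ss h]; apply: lact_cmul_V => {}n.
  apply: assoc_sub => //; first exact: wspan_subspace.
  move=> n' m' l.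
  apply: (cmulS_wspan (m := Ordinal (leq_ltn_trans l (ltn_ord m))) Ss h ds)
    (cmul_words hA hN c0 m' c) => u.
  exact: V_wcat.
have [al ->] := cmul_iterDl i n s (nword c).
apply: subspaceZ; first exact: wspan_subspace.
by apply: wspan_mono (hc s sb (n - i)%N Ss h) => u; apply: V_mono; exact: wle_wDr.
Qed.

(** Associativity only raises the inner index [m + t], so the locality of letters propagates through
    D-free words. Hence right multiplication with [n >= N] yields a composition only when [f] is not
    D-free. *)
Lemma dfree_cmul_gen f b n : elt_dfree N gen f -> (N <= n)%N -> cmul n f (gen b) = 0.
Proof.
move=> df Nn; have [s [c [us _ e]]] := wspan_seq (nword_span hC f).
pose s' := [seq u <- s | c u != 0].
have ef : f = \sum_(u <- s') c u *: nword u.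
  rewrite big_filter e [RHS]big_mkcond; apply: eq_bigr => u _.
  by case: eqP => //= ->; rewrite scale0r.
have e2 : unzip2 [seq (c u, u) | u <- s'] = s' by rewrite /unzip2 -map_comp map_id.
have ds u : u \in s' -> dfree u.
  move=> us'; apply: df; exists [seq (c u, u) | u <- s']; last by rewrite e2.
  split; first by rewrite e2 filter_uniq.
    by move=> x /mapP[v]; rewrite mem_filter => /andP[cv _] ->.
  by rewrite big_map.
have h p b' m : (N <= m)%N -> cmul m (lact p (gen b')) (gen b) = 0.
  elim: p m => [|[b1 n1] p IH] m Nm; first exact: hN.
  rewrite hA big1 // => t _; rewrite IH ?linear0 ?scaler0 //.
  exact: leq_trans Nm (leq_addr _ _).
rewrite ef; apply: (@subspace_sum _ _ (fun x => cmul n x (gen b) = 0)).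
  apply: (@subspace_cmull _ _ (fun x => x = 0)); split=> // a x y -> ->.
  by rewrite scaler0 addr0.
move=> [[p b'] i] /ds /eqP; rewrite /wind /= => ->.
by rewrite cmulZl; have := h p b' n Nn; rewrite /Defs.nword /= => ->; rewrite scaler0.
Qed.

(** Induction on [c]: [s_(n) (b1_(j) [c'])] is rewritten through the products [(s_(n') b1)_(m')
    [c']]. The letter case makes [s_(n') b1] a combination of normal S-words, to which the
    hypothesis on [c'] applies. *)
Lemma right_closedP c : right_closed c.
Proof.
have letter b n s sb : S s -> monic_lead s sb -> SW (V sb 1) (cmul n s (gen b)).
  move=> Ss h; have hV := W_cmul hC n ([::], b, 0%N) (monic_wle h).
  have comp : composition N gen S (cmul n s (gen b)) -> SW (V sb 1) (cmul n s (gen b)).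
    by move=> /composition_span; apply=> // u v hu vu; exact: V_wle vu hu.
  have hb := bar_monic hk hC h.
  (* The product [s_(n) b] is zero, a right multiplication composition, or a normal S-word of the
     first kind. *)
  have [nN|Nn] := ltnP n N; last first.
    have [df|ndf] := pselect (elt_dfree N gen s).
      by rewrite dfree_cmul_gen //; apply: subspace0; exact: wspan_subspace.
    by apply: comp; apply: (CompRightMul _ Ss hb); right.
  have [ds|nds] := boolP (dfree sb); last first.
    by apply: comp; apply: (CompRightMul _ Ss hb); left.
  apply: (wspan_gen (w := wcat sb (Ordinal nN) ([::], b, 0%N))).
    exact: (nsw_S1 (Ordinal nN) ([::], b, 0%N)).
  exact: (V_self (Ordinal nN) ([::], b, 0%N)).
case: c => [[p b] i]; elim: p => [|[b1 j] p IH].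
  elim: i => [|i IH] n s sb Ss h; first exact: letter.
  apply: cmulDr_sub; [exact: wspan_subspace | | exact: IH].
  apply: (V_wspanD nsw_D); exact: IH.
move=> s sb n Ss h.
have -> : wlen ((b1, j) :: p, b, i) = (1 + wlen (p, b, i))%N by [].
apply: assoc_sub_rev => //; first exact: wspan_subspace.
move=> n' m' _; move: (cmul n' s (gen b1)) (letter b1 n' s sb Ss h); apply: wspan_min.
  exact: subspace_cmull (wspan_subspace _ _).
move=> x v hx hv; apply: wspan_mono (right_closed_nsw m' IH hx) => u.
exact: V_trans.
Qed.

Lemma cmul_nsw_word x w n c : nsw x w -> SW (V w (wlen c)) (cmul n x (nword c)).
Proof. apply: right_closed_nsw; exact: right_closedP. Qed.

(** For an S-word of the first kind, [b_(n) (s_(m) [c])] becomes a combination of the [(b_(n')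
    s)_(m') [c]]; this is why right multiplication has to be settled first. For [n >= N] the product
    [b_(n) s] is a left multiplication composition. *)
Lemma cmul_gen_nsw b n x w : nsw x w -> SW (V ([::], b, 0%N) (wlen w)) (cmul n (gen b) x).
Proof.
have letter s sb : S s -> monic_lead s sb -> forall b n,
    SW (V ([::], b, 0%N) (wlen sb)) (cmul n (gen b) s).
  move=> Ss h {}b {}n; have [nN|Nn] := ltnP n N.
    apply: (wspan_gen (w := wctx [:: (b, Ordinal nN)] sb)); last exact: V_single.
    by apply: (nsw_ctx b (Ordinal nN)); exact: nsw_S.
  apply: composition_span; [| exact: CompLeftMul |].
    by move=> u v hu vu; exact: V_wle vu hu.
  move: (monic_wle h); move: {h Ss}s; apply: wspan_min.
    exact: subspace_cmulr (wspan_subspace _ _).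
  move=> s u -> /= us; apply: wspan_mono (cmul_gen_word hA hN b n (erefl (nword u))) => v.
  have := wle_wlen us; rewrite leq_eqVlt => /predU1P[->//|l] [l' _].
  by apply: V_short; apply: leq_ltn_trans l' _.
move=> hx; case: hx b n => [p s sb m c Ss h ds|p s sb i Ss h] b n;
  apply: (cmul_gen_lact hA hN nsw_ctx) => {}b {}n.
  apply: assoc_sub_rev => //; first exact: wspan_subspace.
  move=> n' m' _; rewrite wlen_wcat.
  move: (cmul n' (gen b) s) (letter s sb Ss h b n'); apply: wspan_min.
    exact: subspace_cmull (wspan_subspace _ _).
  move=> y v hy hv; apply: wspan_mono (cmul_nsw_word m' c hy) => u.
  exact: V_trans.
by rewrite wlen_wD; apply: (cmul_gen_iterD nsw_D); exact: letter.
Qed.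

Lemma cmul_span_lt v (m : 'I_N) c z : dfree v -> SW [set u | wlt u v] z ->
  SW [set u | wlt u (wcat v m c)] (cmul m z (nword c)).
Proof.
move=> dv; move: z; apply: wspan_min; first exact: subspace_cmull (wspan_subspace _ _).
move=> x w hx wv; apply: wspan_mono (cmul_nsw_word m c hx) => u.
exact: wlt_V.
Qed.

Lemma subspaceSW P : subspace (SW P). Proof. exact: wspan_subspace. Qed.

Lemma cmul_lact_span p x v (n : 'I_N) c : nsw x v ->
  SW [set u | wlt u (wctx p (wcat v n c))]
    (cmul n (lact p x) (nword c) - lact p (cmul n x (nword c))).
Proof.
move=> hx; apply: (lact_cmul_lead hA nsw_ctx) => m.
by apply: wspan_mono (cmul_nsw_word m c hx) => u [l _]; rewrite /= wlen_wcat.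
Qed.

(** Disjoint occurrences require no overlap composition. Both sides are compared with [s_(m) y]: on
    one side [[v] - y] has only words below [v], on the other [s - [sb]] has only words below
    [sb]. *)
Lemma disjoint_span s sb (m : 'I_N) y v : S s -> monic_lead s sb -> dfree sb -> nsw y v ->
  SW [set u | wlt u (wcat sb m v)]
    (cmul m s (nword v) - lact (rcons (wpre sb) (wlast sb, m)) y).
Proof.
move=> Ss h ds hy; apply: (subspaceBB (subspaceSW _) (y := cmul m s y)).
  rewrite -linearB; apply: (cmulS_wspan Ss h ds) (subspaceBC (wspan_subspace _ _) (nsw_monic hy)).
  by move=> u /=; rewrite wlt_wcatr.
apply: (subspaceBB (subspaceSW _) (y := cmul m (nword sb) y)); last first.
  exact: (cmul_word_lead hA nsw_ctx cmul_gen_nsw).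
have {}h : W [set u | wlt u sb] (s - nword sb) := h.
rewrite -cmulBl; move: (s - _) h; apply: wspan_min.
  exact: subspace_cmull (subspaceSW _).
move=> _ u -> us; apply: wspan_mono (cmul_word hA nsw_ctx cmul_gen_nsw u m hy) => t.
exact: wlt_V.
Qed.

(** * Normal S-words whose occurrences overlap *)

Section Pairs.
Variables (s1 s2 : C) (w1 w2 : word).
Hypotheses (Ss1 : S s1) (h1 : monic_lead s1 w1) (Ss2 : S s2) (h2 : monic_lead s2 w2).
Let b1 := bar_monic hk hC h1.
Let b2 := bar_monic hk hC h2.

(** The pattern of this part: the composition is extended by what follows the overlap (a product or
    a power of [D]), and the extension is then moved inside the brackets; both steps err by lower
    S-words only. *)
Lemma inclusion_span0 p (m : 'I_N) c : dfree w2 -> w1 = wctx p w2 ->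
  SW [set u | wlt u (wcat w1 m c)]
    (cmul m s1 (nword c) - lact p (cmul m s2 (nword c))).
Proof.
move=> d2 e; have d1 : dfree w1 by rewrite e.
have hc : composition N gen S (s1 - lact p s2).
  (* A D-free [w2] at the end of [w1] is a right inclusion with exponent 0. *)
  by apply: (@CompRightInclusion _ _ _ _ _ _ _ s1 s2 w1 w2 p 0); rewrite ?wD0.
have := composition_span_lt hc h1; rewrite e => /(_ (monic_lact _ h2)) H.
apply: (subspaceBB (subspaceSW _) (y := cmul m (lact p s2) (nword c))).
  by rewrite -cmulBl; apply: cmul_span_lt H.
by rewrite -wctx_wcat; apply: cmul_lact_span; exact: nsw_S.
Qed.

Lemma inclusion_span1 p (m n : 'I_N) v c : dfree w2 -> dfree v ->
  w1 = wctx p (wcat w2 n v) ->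
  SW [set u | wlt u (wcat w1 m c)]
    (cmul m s1 (nword c) - lact p (cmul n s2 (nword (wcat v m c)))).
Proof.
move=> d2 dv e; have d1 : dfree w1 by rewrite e.
have hc : composition N gen S (s1 - lact p (cmul n s2 (nword v))).
  exact: (CompInclusion Ss1 Ss2 b1 b2 d2 e).
have hg := nsw_S1 n v Ss2 h2 d2.
have := composition_span_lt hc h1; rewrite e => /(_ (monic_lact _ (nsw_monic hg))) H.
apply: (subspaceBB (subspaceSW _) (y := cmul m (lact p (cmul n s2 (nword v))) (nword c))).
  by rewrite -cmulBl; apply: cmul_span_lt H.
rewrite -wctx_wcat.
apply: (subspaceBB (subspaceSW _) (y := lact p (cmul m (cmul n s2 (nword v)) (nword c)))).
  exact: cmul_lact_span.
rewrite -linearB wcatA.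
apply: (lact_wspan nsw_ctx) (cmul_cmulS n m c Ss2 h2 d2 dv) => u /=.
by rewrite wlt_wctx.
Qed.

Lemma inclusion_spanD p (n : 'I_N) v i : dfree w2 -> w1 = wctx p (wcat w2 n v) ->
  SW [set u | wlt u (wD w1 i)]
    (iter i D s1 - lact p (cmul n s2 (nword (wD v i)))).
Proof.
move=> d2 e.
have hc : composition N gen S (s1 - lact p (cmul n s2 (nword v))).
  exact: (CompInclusion Ss1 Ss2 b1 b2 d2 e).
have hg := nsw_S1 n v Ss2 h2 d2.
have := composition_span_lt hc h1; rewrite e => /(_ (monic_lact _ (nsw_monic hg))) H.
apply: (subspaceBB (subspaceSW _) (y := iter i D (lact p (cmul n s2 (nword v))))).
  by rewrite -iterDB; apply: (iterD_wspan_lt nsw_D).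
rewrite -wctx_wD.
apply: (subspaceBB (subspaceSW _) (y := lact p (iter i D (cmul n s2 (nword v))))).
  exact: (iterD_lact nsw_ctx nsw_D).
rewrite -linearB.
by apply: (lact_wspan nsw_ctx) (iterD_cmulS i n v Ss2 h2 d2) => u /=; rewrite wlt_wctx.
Qed.

Lemma right_inclusion_span p i j : w1 = wctx p (wD w2 j) ->
  SW [set u | wlt u (wD w1 i)] (iter i D s1 - lact p (iter (i + j) D s2)).
Proof.
move=> e; have hc := CompRightInclusion Ss1 Ss2 b1 b2 e.
have hg := nsw_S2 j Ss2 h2.
have := composition_span_lt hc h1; rewrite e => /(_ (monic_lact _ (nsw_monic hg))) H.
apply: (subspaceBB (subspaceSW _) (y := iter i D (lact p (iter j D s2)))).
  by rewrite -iterDB; apply: (iterD_wspan_lt nsw_D).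
by rewrite -wctx_wD iterD; apply: (iterD_lact nsw_ctx nsw_D).
Qed.

Lemma intersection_comp p (m : 'I_N) v : dfree w1 -> p <> [::] ->
  (size p < wlen w1)%N -> wcat w1 m v = wctx p w2 ->
  SW [set u | wlt u (wctx p w2)] (cmul m s1 (nword v) - lact p s2).
Proof.
move=> d1 p0 lp e; have hc : composition N gen S (cmul m s1 (nword v) - lact p s2).
  (* The common word has length [size p + |w2|], so the overlap condition on lengths amounts to
     [size p < |w1|]. *)
  apply: (CompIntersection Ss1 Ss2 b1 b2 d1 p0 e).
  by rewrite e wlen_wctx ltn_add2r.
apply: composition_span_lt hc _ _; last exact: monic_lact.
by rewrite -e; apply: nsw_monic; exact: nsw_S1.
Qed.

Lemma intersection_span p (m n : 'I_N) v c : dfree w1 -> dfree w2 -> p <> [::] ->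
  (size p < wlen w1)%N -> wcat w1 m v = wctx p w2 ->
  SW [set u | wlt u (wctx p (wcat w2 n c))]
    (cmul m s1 (nword (wcat v n c)) - lact p (cmul n s2 (nword c))).
Proof.
move=> d1 d2 p0 lp e; have H := intersection_comp d1 p0 lp e.
have dv : dfree v by have : dfree (wcat w1 m v) by rewrite e.
apply: (subspaceBB (subspaceSW _) (y := cmul n (cmul m s1 (nword v)) (nword c))).
  apply: (subspaceBC (subspaceSW _)); rewrite wctx_wcat -e wcatA.
  exact: cmul_cmulS.
apply: (subspaceBB (subspaceSW _) (y := cmul n (lact p s2) (nword c))).
  by rewrite -cmulBl wctx_wcat; apply: cmul_span_lt H.
by apply: cmul_lact_span; exact: nsw_S.
Qed.

Lemma intersection_spanD p (m : 'I_N) v i : dfree w1 -> p <> [::] ->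
  (size p < wlen w1)%N -> wcat w1 m v = wctx p w2 ->
  SW [set u | wlt u (wctx p (wD w2 i))]
    (cmul m s1 (nword (wD v i)) - lact p (iter i D s2)).
Proof.
move=> d1 p0 lp e; have H := intersection_comp d1 p0 lp e.
apply: (subspaceBB (subspaceSW _) (y := iter i D (cmul m s1 (nword v)))).
  apply: (subspaceBC (subspaceSW _)); rewrite wctx_wD -e -wcat_wD.
  exact: iterD_cmulS.
apply: (subspaceBB (subspaceSW _) (y := iter i D (lact p s2))).
  by rewrite -iterDB wctx_wD; apply: (iterD_wspan_lt nsw_D).
by apply: (iterD_lact nsw_ctx nsw_D); exact: nsw_S.
Qed.

Lemma right_intersection_span p i j : (0 < j)%N -> p <> [::] -> wD w1 j = wctx p w2 ->
  SW [set u | wlt u (wctx p (wD w2 i))] (iter (i + j) D s1 - lact p (iter i D s2)).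
Proof.
move=> j0 p0 e; have hc := CompRightIntersection Ss1 Ss2 b1 b2 j0 p0 e.
have H : SW [set u | wlt u (wctx p w2)] (iter j D s1 - lact p s2).
  apply: composition_span_lt hc _ _; last exact: monic_lact.
  by rewrite -e; exact: monic_iterD.
apply: (subspaceBB (subspaceSW _) (y := iter i D (lact p s2))).
  by rewrite iterD -iterDB wctx_wD; apply: (iterD_wspan_lt nsw_D).
by apply: (iterD_lact nsw_ctx nsw_D); exact: nsw_S.
Qed.

End Pairs.

End Composition.
End NormalSWords.

(** * The equivalences *)

Lemma cat_split (T : eqType) (p a q b : seq T) : p ++ a = q ++ b ->
  (exists2 r, p = q ++ r & b = r ++ a) \/
  (exists x r, q = p ++ x :: r /\ a = x :: r ++ b).
Proof.
elim: p q => [|x p IH] [|y q] /= e.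
- by left; exists [::].
- by right; exists y, q.
- by left; exists (x :: p).
case: e => -> /IH[[r -> ->]|[z [r [-> ->]]]]; first by left; exists r.
by right; exists z, r.
Qed.

Local Open Scope quotient_scope.

Section CompositionDiamond.
Context (k : fieldType) (hk : [pchar k]%R =i pred0).
Context (disp : Order.disp_t) (B : orderType disp) (N : nat).
Context (hB : well_founded (fun x y : B => (x < y)%O)).
Context (C : conformalAlg k) (gen : B -> C) (hC : is_free_conf N gen).
Context (S : set C) (hS : forall s, S s -> conf_monic N gen s).
Local Notation D := (cD C).
Local Notation word := (word B N).
Local Notation W := (wspan (@is_nword k disp B N C gen)).
Local Notation lact := (@lact k disp B N C gen).
Local Notation nword := (@nword k disp B N C gen).
Local Notation monic_lead := (@monic_lead k disp B N C gen).
Local Notation has_lead := (@has_lead k disp B N C gen).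
Local Notation bar := (@bar k disp B N C gen).
Local Notation nsw := (@nsw k disp B N C gen S).
Local Notation SW := (wspan nsw).
Implicit Types (u v w c : word) (P : set word) (f g x y z s : C).

Let hA : conf_assoc C. Proof. by case: hC. Qed.
Let hN : bounded_locality N gen. Proof. by case: hC. Qed.

Let subW P : subspace (W P) := wspan_subspace _ P.
Let subSW P : subspace (SW P) := wspan_subspace _ P.

Section GSBasis.
Hypothesis GS : GS_basis N gen S.

(** The first S-word has an empty left context, so [w1] begins the common word. The cases compare
    where [w2] begins and ends relative to [w1], and each matches one lemma on pairs or
    [disjoint_span]. *)
Lemma diff_first s1 w1 (m1 : 'I_N) c1 y w : S s1 -> monic_lead s1 w1 -> dfree w1 ->
  nsw y w -> wcat w1 m1 c1 = w ->
  SW [set u | wlt u w] (cmul m1 s1 (nword c1) - y).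
Proof.
have df (q : seq (B * 'I_N)) (l : B) : dfree (q, l, 0%N) by [].
move=> S1 h1 d1 [p s2 w2 m2 c2 S2 h2 d2|p s2 w2 i S2 h2].
  case: w1 c1 w2 c2 h1 d1 h2 d2
    => [[q1 l1] k1] [[r1 t1] i1] [[q2 l2] k2] [[r2 t2] i2] h1 /eqP d1 h2 /eqP d2.
  rewrite /wind /= in d1 d2; subst k1 k2.
  rewrite /wcat /wctx /wpre /wlast /wind /= => -[e et ei]; subst t2 i2.
  have [[r ep er]|[x [r [eq1 er]]]] := cat_split (esym e).
    (* Disjoint occurrences: [w2] lies inside [c1]. *)
    have hY : nsw (lact r (cmul m2 s2 (nword (r2, t1, i1)))) (r1, t1, i1).
      have := Nsw1 r m2 (r2, t1, i1) S2 h2 erefl.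
      by rewrite /wctx /wcat /= -er.
    have := disjoint_span hk hC hS GS m1 S1 h1 erefl hY.
    by rewrite -lact_cat /wcat /wctx /= -ep -e.
  have [[r' ex er1]|[x' [r' [ex er2]]]] := cat_split (er : _ = (x :: r) ++ r1).
    (* An empty [r'] means that [w1] and [w2] end at the same letter; otherwise [w2] ends later. *)
    case/lastP: r' ex er1 => [|r' [l3 m3]] ex er1.
      move: ex eq1; rewrite cats0 => <-; rewrite -rcons_cat => /rcons_inj[e1 e2 e3].
      subst q1 l2 m2; have er12 : r1 = r2 by [].
      rewrite -er12.
      have := inclusion_span0 hk hC hS GS S1 h1 S2 h2 m1 (r1, t1, i1) erefl erefl.
      by rewrite /wcat /wctx /= e -er12.
    move: ex; rewrite -rcons_cat => /rcons_inj[e1 e2 e3]; subst l3 m3.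
    pose v : word := (r', l2, 0%N).
    have ew : wcat (q1, l1, 0%N) m1 v = wctx p (q2, l2, 0%N).
      by rewrite /wcat /wctx /= eq1 e1 -catA.
    have ec : wcat v m2 (r2, t1, i1) = (r1, t1, i1) by rewrite /wcat /wctx /= er1.
    (* For empty [p], [w1] is an initial part of [w2], an inclusion with the roles exchanged;
       otherwise the two words properly intersect. *)
    rewrite -ec; case: p e eq1 ew => [|x0 p] e eq1 ew.
      apply: (subspaceBC (subSW _)).
      exact: (@inclusion_span1 _ hk _ _ _ _ _ hC _ hS GS _ _ _ _ S2 h2 S1 h1 [::] m2 m1 v
        (r2, t1, i1) (df _ _) (df _ _) (esym ew)).
    have lp : (size (x0 :: p) < wlen ((q1, l1, 0%N) : word))%N.
      rewrite /wlen /wpre /= -(size_rcons q1 (l1, m1)) eq1 size_cat /=; lia.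
    have p0 : x0 :: p <> [::] by [].
    exact: (@intersection_span _ hk _ _ _ _ _ hC _ hS GS _ _ _ _ S1 h1 S2 h2 (x0 :: p) m1 m2 v
        (r2, t1, i1) (df _ _) (df _ _) p0 lp ew).
  (* [w2] ends before [w1] does, so it is included in [w1] with the nonempty rest [v]. *)
  move: ex er2; rewrite -cat_cons [x' :: r']lastI; move: (belast _ _) (last _ _) => r3 [l3 m3] ex er2.
  move: eq1; rewrite ex -!rcons_cat => /rcons_inj[e1 e2 e3]; subst l3 m3 q1.
  pose v : word := (r3, l1, 0%N).
  have ec : wcat v m1 (r1, t1, i1) = (r2, t1, i1) by rewrite /wcat /wctx /= er2.
  have := @inclusion_span1 _ hk _ _ _ _ _ hC _ hS GS _ _ _ _ S1 h1 S2 h2 p m1 m2 v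
      (r1, t1, i1) (df _ _) (df _ _) erefl.
  by rewrite ec /wcat /wctx /= e.
case: w1 c1 w2 h1 d1 h2 => [[q1 l1] k1] [[r1 t1] i1] [[q2 l2] k2] h1 /eqP d1 h2.
rewrite /wind /= in d1; subst k1.
rewrite /wcat /wctx /wD /wpre /wlast /wind /= => -[e et ei]; subst t1 i1.
have [[r ep er]|[x [r [eq1 er]]]] := cat_split (esym e).
  have hY : nsw (lact r (iter i D s2)) (r1, l2, (k2 + i)%N).
    have := Nsw2 r i S2 h2.
    by rewrite /wctx /wD /= -er.
  have := disjoint_span hk hC hS GS m1 S1 h1 erefl hY.
  by rewrite -lact_cat /wcat /wctx /= -ep -e.
(* [w2] begins inside [w1] and reaches the end of the common word; [v] is the part of it beyond
   [w1], before [D^i] is applied. *)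
pose v : word := (r1, l2, k2).
have ew : wcat (q1, l1, 0%N) m1 v = wctx p (q2, l2, k2).
  by rewrite /wcat /wctx /= eq1 er -catA.
have -> : (r1, l2, (k2 + i)%N) = wD v i by [].
case: p e eq1 ew => [|x0 p] e eq1 ew.
  apply: (subspaceBC (subSW _)).
  exact: (@inclusion_spanD _ hk _ _ _ _ _ hC _ hS GS _ _ _ _ S2 h2 S1 h1 [::] m1 v i
    (df _ _) (esym ew)).
have lp : (size (x0 :: p) < wlen ((q1, l1, 0%N) : word))%N.
  rewrite /wlen /wpre /= -(size_rcons q1 (l1, m1)) eq1 size_cat /=; lia.
have p0 : x0 :: p <> [::] by [].
exact: (@intersection_spanD _ hk _ _ _ _ _ hC _ hS GS _ _ _ _ S1 h1 S2 h2 (x0 :: p) m1 v i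
  (df _ _) p0 lp ew).
Qed.

Lemma diff_second s1 w1 i y w : S s1 -> monic_lead s1 w1 -> nsw y w -> wD w1 i = w ->
  SW [set u | wlt u w] (iter i D s1 - y).
Proof.
move=> S1 h1 [p s2 w2 m2 c2 S2 h2 d2|p s2 w2 j S2 h2].
  case: w1 c2 h1 => [[q1 l1] k1] [[r2 t2] i2] h1.
  rewrite /wcat /wctx /wD /wpre /wlast /wind /= => -[e et ei]; subst q1 l1 i2.
  exact: (@inclusion_spanD _ hk _ _ _ _ _ hC _ hS GS _ _ _ _ S1 h1 S2 h2 p m2 (r2, t2, k1) i d2 erefl).
case: w1 w2 h1 h2 => [[q1 l1] k1] [[q2 l2] k2] h1 h2.
rewrite /wctx /wD /wpre /wlast /wind /= => -[e et ei]; subst q1 l1; rewrite -ei.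
(* Both occurrences reach the end, so the exponents decide. If [i <= j], [w1] ends in [w2] with
   exponent raised by [j - i]; otherwise [w2] carries the surplus, a right intersection unless [p]
   is empty, when the roles are exchanged. *)
have [ij|ji] := leqP i j.
  have ek : k1 = (k2 + (j - i))%N by lia.
  subst k1; have := @right_inclusion_span _ hk _ _ _ _ _ hC _ hS GS _ _ _ _ S1 h1 S2 h2 p i (j - i) erefl.
  by rewrite subnKC.
have ek : k2 = (k1 + (i - j))%N by lia.
subst k2; case: p h1 => [|x0 p] h1.
  apply: (subspaceBC (subSW _)).
  have := @right_inclusion_span _ hk _ _ _ _ _ hC _ hS GS _ _ _ _ S2 h2 S1 h1 [::] j (i - j) erefl.
  by rewrite subnKC ?(ltnW ji) // /wD /wpre /wlast /wind /= ei.
have p0 : x0 :: p <> [::] by [].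
have j0 : (0 < i - j)%N by lia.
have := @right_intersection_span _ hk _ _ _ _ _ hC _ hS GS _ _ _ _ S1 h1 S2 h2
  (x0 :: p) j (i - j) j0 p0 erefl.
by rewrite subnKC ?(ltnW ji) // /wctx /wD /wpre /wlast /wind /= ei.
Qed.

Lemma nsw_diff x y w : nsw x w -> nsw y w -> SW [set u | wlt u w] (x - y).
Proof.
have key x0 v0 p q y0 v : (forall y w, nsw y w -> v0 = w -> SW [set u | wlt u w] (x0 - y)) ->
    nsw y0 v -> wctx p v0 = wctx (p ++ q) v ->
    SW [set u | wlt u (wctx p v0)] (lact p x0 - lact (p ++ q) y0).
  move=> h hy; rewrite wctx_cat => /wctx_inj e; rewrite lact_cat -linearB.
  apply: (lact_wspan (nsw_ctx (S := S))) (h _ _ (Flact (nsw_ctx (S := S)) q hy) e) => u /=.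
  by rewrite -e wlt_wctx.
have split x0 u : nsw x0 u -> exists p x1 v, [/\ x0 = lact p x1, u = wctx p v, nsw x1 v &
    forall y w, nsw y w -> v = w -> SW [set u | wlt u w] (x1 - y)].
  case=> [p s sb m c Ss h ds|p s sb i Ss h].
    exists p, (cmul m s (nword c)), (wcat sb m c); split=> //; first exact: nsw_S1.
    by move=> y1 w1 hy; exact: diff_first.
  exists p, (iter i D s), (wD sb i); split=> //; first exact: nsw_S2.
  by move=> y1 w1 hy; exact: diff_second.
move=> /split[p1 [x1 [v1 [-> -> hx1 H1]]]] /split[p2 [x2 [v2 [-> e hx2 H2]]]].
(* One left context is an initial part of the other and is stripped from both, which leaves one
   S-word with an empty context. *)
have [[r ep _]|[z [r [ep _]]]] := cat_split (congr1 (@wpre _ _ _) e).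
  rewrite e ep; apply: (subspaceBC (subSW _)); apply: key hx1 _ => //.
  by rewrite -ep.
by rewrite ep; apply: key hx2 _ => //; rewrite -ep.
Qed.

(** Minimality of [Id S]: by the product estimates the span of the normal S-words is itself an
    ideal, and it contains [S]. *)
Lemma Id_SW f : Id S f -> SW setT f.
Proof.
apply; split; last first.
  move=> s Ss; have [w hw] := monicS hS Ss.
  by apply: (wspan_gen (w := w)) => //; exact: nsw_S.
split; first exact: (subspace0 (subSW _)).
- by move=> a x y hx hy; case: (subSW setT) => _; apply.
- by move=> x; apply: (D_wspan (@nsw_D _ _ _ _ _ _ S)).
- move=> n a x; move: a (nword_span hC a); apply: (wspan_min (Q := fun a =>
    SW setT x -> SW setT (cmul n a x))).
    split=> [_|a y z hy hz hx]; first by rewrite cmul0l; exact: (subspace0 (subSW _)).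
    rewrite cmulDl cmulZl; apply: (subspaceD (subSW _)); last exact: hz.
    by apply: (subspaceZ (subSW _)); exact: hy.
  move=> _ u -> _; move: x; apply: wspan_min; first exact: subspace_cmulr (subSW _).
  move=> x w hx _.
  by apply: wspan_mono (cmul_word hA (nsw_ctx (S := S)) (cmul_gen_nsw hk hC hS GS) u n hx).
- move=> n x a; move: a (nword_span hC a); apply: (wspan_min (Q := fun a =>
    SW setT x -> SW setT (cmul n x a))).
    split=> [_|a y z hy hz hx]; first by rewrite linear0; exact: (subspace0 (subSW _)).
    rewrite linearP; apply: (subspaceD (subSW _)); last exact: hz.
    by apply: (subspaceZ (subSW _)); exact: hy.
  move=> _ u -> _; move: x; apply: wspan_min; first exact: subspace_cmull (subSW _).
  move=> x w hx _; by apply: wspan_mono (cmul_nsw_word hk hC hS GS n u hx).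
Qed.

Lemma SW_max P f : SW P f -> f = 0 \/ exists2 w, P w & SW [set u : word | wle u w] f.
Proof.
elim=> [|a x y [w hx Pw] _ [->|[w' Pw' hy]]]; first by left.
  right; exists w => //; rewrite addr0; apply: (subspaceZ (subSW _)).
  by apply: wspan_gen hx _; exact: wle_refl.
right; have [ww|ww] := orP (wle_total w w').
  exists w' => //; apply: (subspaceD (subSW _) _ hy); apply: (subspaceZ (subSW _)).
  by apply: wspan_gen hx _.
exists w => //; apply: (subspaceD (subSW _)).
  by apply: (subspaceZ (subSW _)); apply: wspan_gen hx _; exact: wle_refl.
by apply: wspan_mono hy => u /= h; apply: wle_trans h ww.
Qed.

(** By [nsw_diff] all terms with leading word [w] merge into a multiple of a single one, up to lower
    S-words. *)
Lemma SW_top w f : SW [set u : word | wle u w] f -> SW [set u | wlt u w] f \/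
  exists x a, nsw x w /\ SW [set u | wlt u w] (f - a *: x).
Proof.
elim=> [|a x y [v hx /= vw] _ IH]; first by left; exact: (subspace0 (subSW _)).
move: vw; rewrite wle_eqVlt => /predU1P[ev|vw].
  subst v; right; case: IH => [hy|[x0 [b [hx0 hy]]]].
    by exists x, a; split=> //; rewrite addrAC subrr add0r.
  exists x, (a + b); split=> //.
  have -> : a *: x + y - (a + b) *: x = (y - b *: x0) + b *: (x0 - x).
    by rewrite scalerDl opprD addrA (addrAC (a *: x)) subrr add0r scalerBr addrA subrK.
  by apply: (subspaceD (subSW _) hy); apply: (subspaceZ (subSW _)); exact: nsw_diff.
have hax : SW [set u | wlt u w] (a *: x).
  by apply: (subspaceZ (subSW _)); by apply: wspan_gen hx _.
case: IH => [hy|[x0 [b [hx0 hy]]]]; first by left; exact: (subspaceD (subSW _) hax hy).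
by right; exists x0, b; split=> //; rewrite -addrA; exact: (subspaceD (subSW _) hax hy).
Qed.

(** Well-founded descent on the bound [w]: either the merged coefficient of the top S-word is
    nonzero and gives the leading word of [f], or the top cancels and the bound drops. *)
Lemma SW_lead w f : SW [set u : word | wle u w] f ->
  f = 0 \/ exists x v a, nsw x v /\ has_lead f a v.
Proof.
move: w f; apply: (well_founded_ind (wlt_wf hB)) => w IH f /SW_top.
have low g : SW [set u | wlt u w] g -> g = 0 \/ exists x v a, nsw x v /\ has_lead g a v.
  by move=> /SW_max[->|[w' w'w h]]; [left | exact: IH w'w _ h].
case=> [/low //|[x [a [hx hf]]]].
have [a0|a0] := eqVneq a 0.
  by apply: low; move: hf; rewrite a0 scale0r subr0.
right; exists x, w, a; split=> //; split=> //.
apply: (subspaceBB (subW _) (y := a *: x)).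
  move: hf; apply: wspan_min => [|y v hy /= vw]; first exact: subW.
  apply: wspan_mono (monic_wle (nsw_monic hC hy)) => u /= h.
  exact: wle_lt_trans h vw.
by rewrite -scalerBr; apply: (subspaceZ (subW _)); exact: (nsw_monic hC hx).
Qed.

Lemma GS_lead_in_Id : lead_in_Id N gen S.
Proof.
move=> f f0 /Id_SW /SW_max[//|[w _ /SW_lead[//|[x [v [a [hx hf]]]]]]].
exists x; first by apply/(normal_SwordE hk hC hS); exists v.
by rewrite (bar_has_lead hk hC hf) (nsw_bar hk hC hx).
Qed.

End GSBasis.

(** * Reduction modulo the ideal *)

Lemma IdB f g : Id S f -> Id S g -> Id S (f - g).
Proof.
move=> hf hg; have [_ h _ _ _] := Id_ideal S.
by rewrite addrC -scaleN1r; exact: h.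
Qed.

Lemma Id_lact p x : Id S x -> Id S (lact p x).
Proof. by move=> hx; elim: p => // bn p IH; have [_ _ _ h _] := Id_ideal S; exact: h. Qed.

Lemma Id_iterD i x : Id S x -> Id S (iter i D x).
Proof. by move=> hx; elim: i => // i IH; have [_ _ h _ _] := Id_ideal S; exact: h. Qed.

Lemma Id_S s : S s -> Id S s.
Proof. by move=> Ss I [_]; apply. Qed.

Lemma Id_nsw x w : nsw x w -> Id S x.
Proof.
have [_ _ _ _ h] := Id_ideal S.
by case=> *; apply: Id_lact; [apply: h | apply: Id_iterD]; exact: Id_S.
Qed.

Lemma Id_subspace : subspace (Id S).
Proof. by have [h0 h _ _ _] := Id_ideal S; split. Qed.

Lemma composition_Id h : composition N gen S h -> Id S h.
Proof.
have [_ _ _ hl hr] := Id_ideal S.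
case=> *; try apply: IdB; rewrite ?/D; do ?[exact: Id_S | apply: Id_lact | apply: Id_iterD |
  apply: hr; exact: Id_S | apply: hl; exact: Id_S].
Qed.

Definition strict_seq (e : seq (k * C)) :=
  sorted (fun t t' : k * C => wlt0 (bar t'.2) (bar t.2)) e.

(** Subtracting the S-word with the leading word of [f] stays in the ideal and lowers that word. The
    last clause, that all terms are at most [w], is the form in which triviality of compositions is
    read off. *)
Lemma lead_strict : lead_in_Id N gen S -> forall w f a, has_lead f a w -> Id S f ->
  exists (x : k * C) (e : seq (k * C)),
    [/\ {in x :: e, forall t, normal_Sword N gen S t.2},
        f = \sum_(t <- x :: e) t.1 *: t.2, bar x.2 = Some w,
        strict_seq (x :: e) & {in x :: e, forall t, wle0 (bar t.2) (Some w)}].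
Proof.
move=> hlead; apply: (well_founded_ind (wlt_wf hB)) => w IH f a hf If.
have f0 : f <> 0.
  move=> f0; have := @bar_eqNone k hk _ B N C gen hC.
  by rewrite -f0 (bar_has_lead hk hC hf).
have [x nx] := hlead f f0 If; rewrite (bar_has_lead hk hC hf) => /esym bx.
have [v hx] := (normal_SwordE hk hC hS x).1 nx.
have ev : v = w by move: bx; rewrite (nsw_bar hk hC hx) => -[].
subst v; pose g := f - a *: x.
have hg : W [set u | wlt u w] g.
  apply: (subspaceBB (subW _) hf.2); apply: (subspaceBC (subW _)).
  by rewrite -scalerBr; apply: (subspaceZ (subW _)); exact: (nsw_monic hC hx).
have Ig : Id S g.
  apply: IdB => //; have [_ h _ _ _] := Id_ideal S.
  rewrite -[_ *: _]addr0; apply: h; [exact: Id_nsw hx | exact: (subspace0 Id_subspace)].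
have ef : f = a *: x + g by rewrite addrC subrK.
have [g0|/eqP g0] := eqVneq g 0.
  exists (a, x), [::]; split=> //.
  - by move=> y; rewrite inE => /eqP ->.
  - by rewrite big_seq1 ef g0 addr0.
  - by move=> y; rewrite inE => /eqP -> /=; rewrite bx; exact: wle_refl.
have [b [w' [w'w hg']]] := has_lead_exists g0 hg.
have [x' [e [e1 e2 e3 e4 e5]]] := IH w' w'w g b hg' Ig.
exists (a, x), (x' :: e); split=> //.
- by move=> y; rewrite inE => /predU1P[->//|/e1].
- by rewrite big_cons -e2.
- by rewrite /strict_seq /= e3 bx /wlt0 /= -wltNge w'w; exact: e4.
- move=> y; rewrite inE => /predU1P[->|/e5] /=; first by rewrite bx; exact: wle_refl.
  case: (bar y.2) => // t h; exact: wle_trans h (wltW w'w).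
Qed.

Lemma lead_strict_expansion : lead_in_Id N gen S -> strict_expansion_in_Id N gen S.
Proof.
move=> hlead f f0 If; have [a [w hf]] := bar_neq0 hC f0.
have [x [e [e1 e2 e3 e4 _]]] := lead_strict hlead hf If.
by exists x, e; rewrite (bar_has_lead hk hC hf).
Qed.

Lemma lead_GS : lead_in_Id N gen S -> GS_basis N gen S.
Proof.
move=> hlead h hc; have [->|/eqP h0] := eqVneq h 0.
  by exists [::]; split=> //; rewrite big_nil.
have [a [w hh]] := bar_neq0 hC h0.
have [x [e [e1 e2 _ _ e3]]] := lead_strict hlead hh (composition_Id hc).
by exists (x :: e); rewrite (bar_has_lead hk hC hh).
Qed.

(** A reducible [u] is replaced by the lower words of [[u] - x], where [x] is an S-word led by [u].
    The bound by [u] is needed for [Irr_lead], where reduction must not reach the leading word. *)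
Lemma Irr_reduce u : exists2 g, W [set v | Irr gen S v /\ wle v u] g &
  Id S (nword u - g).
Proof.
move: u; apply: (well_founded_ind (wlt_wf hB)) => u IH.
have [iu|niu] := pselect (Irr gen S u).
  exists (nword u); last by rewrite subrr; exact: (subspace0 Id_subspace).
  by apply: W_word; split=> //; exact: wle_refl.
have [x nx bx] : exists2 x, normal_Sword N gen S x & bar x = Some u.
  apply: contrapT => h; apply: niu => x nx e; apply: h; exists x => //.
have [v hx] := (normal_SwordE hk hC hS x).1 nx.
have ev : v = u by move: bx; rewrite (nsw_bar hk hC hx) => -[].
subst v; have [g hg Ig] : exists2 g, W [set v | Irr gen S v /\ wle v u] g &
    Id S ((nword u - x) - g).
  move: (nword u - x) (subspaceBC (subW _) (nsw_monic hC hx)); apply: wspan_min.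
    split=> [|a y z [gy hy Iy] [gz hz Iz]].
      by exists 0; [exact: (subspace0 (subW _)) | rewrite subrr; exact: (subspace0 Id_subspace)].
    exists (a *: gy + gz); first by case: (subW [set v | Irr gen S v /\ wle v u]) => _; apply.
    have -> : a *: y + z - (a *: gy + gz) = a *: (y - gy) + (z - gz).
      by rewrite scalerBr opprD addrACA.
    by case: Id_subspace => _; apply.
  move=> _ v -> /= vu; have [g hg Ig] := IH v vu; exists g => //.
  by apply: wspan_mono hg => t [it tv]; split=> //; exact: wle_trans tv (wltW vu).
exists g => //.
have -> : nword u - g = (nword u - x - g) + x by rewrite (addrAC _ (- x)) subrK.
apply: (subspaceD Id_subspace Ig); exact: Id_nsw hx.
Qed.

Lemma Irr_reduce_lt w f : W [set u | wlt u w] f ->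
  exists2 g, W [set v | Irr gen S v /\ wlt v w] g & Id S (f - g).
Proof.
move: f; apply: wspan_min.
  split=> [|a y z [gy hy Iy] [gz hz Iz]].
    by exists 0; [exact: (subspace0 (subW _)) | rewrite subrr; exact: (subspace0 Id_subspace)].
  exists (a *: gy + gz); first by case: (subW [set v | Irr gen S v /\ wlt v w]) => _; apply.
  have -> : a *: y + z - (a *: gy + gz) = a *: (y - gy) + (z - gz).
    by rewrite scalerBr opprD addrACA.
  by case: Id_subspace => _; apply.
move=> _ v -> /= vw; have [g hg Ig] := Irr_reduce v; exists g => //.
by apply: wspan_mono hg => t [it tv]; split=> //; exact: wle_lt_trans tv vw.
Qed.

Lemma pi_eq0 f : (\pi_(quotId S) f = 0) <-> Id S f.
Proof.
have -> : (0 : quotId S) = \pi_(quotId S) 0 by rewrite raddf0.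
split=> [/eqP|h].
  by rewrite -Quotient.idealrBE subr0 => /asboolP.
by apply/eqP; rewrite -Quotient.idealrBE subr0; apply/asboolP.
Qed.

Lemma pi_sum (s : seq word) (c : word -> k) :
  \sum_(u <- s) c u *: \pi_(quotId S) (nword u) = \pi_(quotId S) (\sum_(u <- s) c u *: nword u).
Proof.
rewrite raddf_sum; apply: eq_bigr => u _; exact/esym/pi_quotId_scale.
Qed.

Lemma strict_Irr : strict_expansion_in_Id N gen S -> Irr_basis N gen S.
Proof.
move=> hs; split=> [s c us Is|x].
  rewrite pi_sum => /pi_eq0 If; set f := \sum_(u <- s) _ in If.
  have [f0|/eqP f0] := eqVneq f 0; first exact: (nword_independent hk hC us f0).
  have Wf : W [set u | u \in s] f.
    apply: (subspace_sum (subW _)) => u ius; apply: (subspaceZ (subW _)); exact: W_word.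
  have [a [w [ws hf]]] := has_lead_exists f0 Wf.
  have [y [e [e1 _ e3 _]]] := hs f f0 If.
  exfalso; apply: (Is w ws y.2 (e1 _ (mem_head _ _))).
  by rewrite -e3 (bar_has_lead hk hC hf).
have [g hg Ig] : exists2 g, W [set v | Irr gen S v] g & Id S (repr x - g).
  move: (repr x) (nword_span hC (repr x)); apply: wspan_min.
    split=> [|a y z [gy hy Iy] [gz hz Iz]].
      by exists 0; [exact: (subspace0 (subW _)) | rewrite subrr; exact: (subspace0 Id_subspace)].
    exists (a *: gy + gz); first by case: (subW [set v | Irr gen S v]) => _; apply.
    have -> : a *: y + z - (a *: gy + gz) = a *: (y - gy) + (z - gz).
      by rewrite scalerBr opprD addrACA.
    by case: Id_subspace => _; apply.
  move=> _ u -> _; have [g hg Ig] := Irr_reduce u; exists g => //.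
  by apply: wspan_mono hg => t [].
have [s [c [us Is eg]]] := wspan_seq hg.
exists s, c; split=> //; rewrite pi_sum -eg.
by apply/eqP; rewrite -[x]reprK -Quotient.idealrBE; apply/asboolP.
Qed.

(** If the leading word [w] of [f] were irreducible, reducing the rest of [f] to irreducible words
    below [w] would give a relation modulo the ideal in which [w] keeps its nonzero coefficient. *)
Lemma Irr_lead : Irr_basis N gen S -> lead_in_Id N gen S.
Proof.
move=> [hi _] f f0 If; have [a [w hf]] := bar_neq0 hC f0.
rewrite (bar_has_lead hk hC hf).
suff niw : ~ Irr gen S w.
  by apply: contrapT => h; apply: niw => x nx e; apply: h; exists x.
move=> iw; have [g hg Ig] := Irr_reduce_lt hf.2.
have [s [c [us sw eg]]] := wspan_seq hg.
have Iag : Id S (a *: nword w + g).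
  have -> : a *: nword w + g = f - (f - a *: nword w - g).
    by rewrite !opprB addrCA [f + _]addrC subrK addrC.
  exact: IdB.
have nws : w \notin s by apply/negP => /sw[_]; rewrite wlt_irr.
have := hi (w :: s) (fun v => if v == w then a else c v).
rewrite /= nws us => /(_ isT) h.
have a0 : a = 0.
  have := h _ _ w (mem_head _ _); rewrite eqxx; apply.
    by move=> v; rewrite inE => /predU1P[->//|/sw[]].
  rewrite pi_sum; apply/pi_eq0; move: Iag; rewrite eg; congr (Id S).
  rewrite big_cons eqxx; congr (_ + _); apply: eq_big_seq => v vs.
  by case: eqP => // ev; move: nws; rewrite -ev vs.
by case: hf => /eqP.
Qed.

End CompositionDiamond.

Theorem theorem3p19 (k : fieldType) (hk : [pchar k]%R =i pred0)
    (disp : Order.disp_t) (B : orderType disp)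
    (hB : well_founded (fun x y : B => (x < y)%O))
    (N : nat) (C : conformalAlg k) (gen : B -> C)
    (hC : is_free_conf N gen)
    (S : set C) (hS : forall s, S s -> conf_monic N gen s) :
  [<-> GS_basis N gen S;
       lead_in_Id N gen S;
       strict_expansion_in_Id N gen S;
       Irr_basis N gen S].
Proof.
tfae.
- exact: (GS_lead_in_Id hk hB hC hS).
- exact: (lead_strict_expansion hk hB hC hS).
- exact: (strict_Irr hk hB hC hS).
(* The cycle closes through (ii): compositions lie in the ideal, and their strict expansions are the
   required trivial forms. *)
- by move=> /(Irr_lead hk hB hC hS); apply: (lead_GS hk hB hC hS).
Qed.
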